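(* The 1-form $\Omega_2=-y\,dx+(x^2+y)\,dy$ on $\mathbb{C}^2$ admits a first integral $F$ of the form $$F(x,y)=\frac{2xY_0(2\sqrt{y})-2\sqrt{y}\,Y_1(2\sqrt{y})}{xJ_0(2\sqrt{y})-\sqrt{y}\,J_1(2\sqrt{y})},$$ where $J_0,J_1$ are the Bessel functions of first type and $Y_0,Y_1$ are the Bessel functions of second type, of orders $0$ and $1$. The function $F$ is well-defined complex analytic in open subsets of the form $(x,y)\in\mathbb{C}\times(\mathbb{C}\setminus L)$, where $L$ is a closed segment of line starting from the origin of $\mathbb{C}$.
   Context: The 1-form $\Omega_2$ is called the Hill fundamental form, or Hill form. A first integral of a 1-form $\Omega$ is a non-constant function $F$ with $\Omega\wedge dF=0$. The Bessel functions of first type (first kind) are $J_\nu(z)=\sum_{k\ge 0}\frac{(-1)^k}{\Gamma(k+1)\Gamma(\nu+k+1)}\left(\frac z2\right)^{2k+\nu}$; those of second type (second kind) are $Y_\nu(z)=\frac{J_\nu(z)\cos(\nu\pi)-J_{-\nu}(z)}{\sin(\nu\pi)}$ for $\nu\notin\mathbb{Z}$ and $Y_n(z)=\lim_{\nu\to n}Y_\nu(z)$ for $n\in\mathbb{Z}$.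
   Formalization: F has poles in C×(C∖L) where its denominator vanishes, so it is shown to be analytic and a first integral off those zeros; at them the numerator is nonzero and 1/F is analytic. L is a closed half-line from the origin, since for a bounded segment log y is not single-valued. *)

(* Defs.v *)
From HB Require Import structures.
From mathcomp Require Import all_boot all_order all_algebra.
From mathcomp Require Import complex.
From mathcomp Require Import all_classical all_reals all_analysis.

Set Implicit Arguments.
Unset Strict Implicit.
Unset Printing Implicit Defensive.

Import Order.TTheory GRing.Theory Num.Theory.
Import numFieldNormedType.Exports.

Local Open Scope classical_set_scope.
Local Open Scope ring_scope.
Local Open Scope complex_scope.

(* R[i] has no canonical topology, but any numFieldType has one; going through
   the structure makes CC R * CC R a normed space over CC R, so that the
   library's differential ['d F p] is the complex one. *)
Definition CC (R : realType) : numClosedFieldType := R[i].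

Section ComplexFunctions.
Variable R : realType.
Implicit Types (z a : CC R) (alpha : R).

Definition cexp z : CC R :=
  (expR (complex.Re z))%:C * (cos (complex.Im z) +i* sin (complex.Im z)).

Definition ccos z : CC R := (cexp ('i * z) + cexp (- ('i * z))) / 2.

Definition csin z : CC R := (cexp ('i * z) - cexp (- ('i * z))) / (2 * 'i).

(* The closed half-line from the origin in the direction alpha + pi. *)
Definition slit_ray alpha : set (CC R) :=
  [set z | exists2 t : R, 0 <= t & z = t%:C * cexp ('i * (alpha + pi)%:C)].

(* The branch of the logarithm cut along [slit_ray alpha], whose argument lies in
   ]alpha - pi, alpha + pi]; alpha = 0 is the principal branch.  As alpha ranges
   over R (not only modulo 2 pi), every branch on every slit plane is obtained.
   The value at z = 0 is irrelevant. *)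
Definition clog alpha z : CC R :=
  get [set w : CC R | cexp w = z /\
         alpha - pi < complex.Im w <= alpha + pi].

Definition cpow alpha z a : CC R :=
  if z == 0 then (a == 0)%:R else cexp (a * clog alpha z).

Definition csqrt alpha z : CC R := cpow alpha z 2^-1.

(* Euler-Gauss limit n! n^z / (z (z + 1) ... (z + n)), valid on the whole domain
   of Gamma.  At the poles z = 0, -1, -2, ... the quotient is eventually x / 0 = 0,
   so that (Gamma z)^-1 = 0 there, as is customary for 1 / Gamma. *)
Definition Gamma z : CC R :=
  lim ((fun n : nat => n`!%:R * cexp (z * (ln (n%:R : R))%:C)
                       / \prod_(k < n.+1) (z + k%:R)) @ \oo).

(* In the Bessel functions alpha selects the branch of (z / 2) ^ nu. *)
Definition besselJ alpha (nu z : CC R) : CC R :=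
  lim (series (fun k : nat =>
         (-1) ^+ k / (Gamma (k%:R + 1) * Gamma (nu + k%:R + 1))
         * cpow alpha (z / 2) (2 * k%:R + nu)) @ \oo).

Definition besselY_nonint alpha (nu z : CC R) : CC R :=
  (besselJ alpha nu z * ccos (nu * pi%:C) - besselJ alpha (- nu) z)
  / csin (nu * pi%:C).

Definition besselY alpha (nu z : CC R) : CC R :=
  if `[< exists n : int, nu = n%:~R >]
  then lim ((fun mu : CC R => besselY_nonint alpha mu z) @ nu^')
  else besselY_nonint alpha nu z.

End ComplexFunctions.

Section FormsOnC2.
Variable R : realType.
Local Notation C := (CC R).
Local Notation C2 := (CC R * CC R)%type.

(* The bound makes the double power series absolutely convergent on the
   polydisc of radius r, so that summing it by total degree is harmless.
   In C, 0 < r says that r is a positive real. *)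
Definition analytic_at (f : C2 -> C) (p : C2) : Prop :=
  exists (a : nat -> nat -> C) (r M : C),
    [/\ 0 < r,
        forall i j, `|a i j| * r ^+ (i + j) <= M &
        forall h k : C, `|h| < r -> `|k| < r ->
          series (fun n : nat =>
            \sum_(i < n.+1) a i (n - i)%N * h ^+ i * k ^+ (n - i)) @ \oo
          --> f (p.1 + h, p.2 + k)].

(* A 1-form is a function of a point and a tangent vector, linear in the
   latter; a 2-form is a function of a point and two tangent vectors. *)
Definition form1 (P Q : C2 -> C) : C2 -> C2 -> C :=
  fun p v => P p * v.1 + Q p * v.2.

Definition exterior_d (F : C2 -> C) : C2 -> C2 -> C := fun p v => 'd F p v.

Definition wedge (w1 w2 : C2 -> C2 -> C) : C2 -> C2 -> C2 -> C :=
  fun p u v => w1 p u * w2 p v - w1 p v * w2 p u.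

Definition first_integral (w : C2 -> C2 -> C) (U : set C2) (F : C2 -> C) : Prop :=
  [/\ forall p, U p -> differentiable F p,
      exists p q, [/\ U p, U q & F p != F q] &
      forall p, U p -> forall u v, wedge w (exterior_d F) p u v = 0].

Definition Omega2 : C2 -> C2 -> C :=
  form1 (fun p => - p.2) (fun p => p.1 ^+ 2 + p.2).

Definition slit_domain (alpha : R) : set C2 := [set p | ~ slit_ray alpha p.2].

(* On [~` slit_ray alpha] the argument of [csqrt alpha y] lies within pi / 2 of
   alpha / 2, hence 2 sqrt y avoids [slit_ray (alpha / 2)]: this is the branch with
   which the Bessel functions are analytic in y.  For alpha = 0 all the
   functions involved are the principal ones. *)
Definition hill_num (alpha : R) (p : C2) : C :=
  let s := csqrt alpha p.2 in
  2 * p.1 * besselY (alpha / 2) 0 (2 * s) - 2 * s * besselY (alpha / 2) 1 (2 * s).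

Definition hill_den (alpha : R) (p : C2) : C :=
  let s := csqrt alpha p.2 in
  p.1 * besselJ (alpha / 2) 0 (2 * s) - s * besselJ (alpha / 2) 1 (2 * s).

Definition hill_F (alpha : R) (p : C2) : C := hill_num alpha p / hill_den alpha p.

End FormsOnC2.

(* Main.v *)
Require Import Defs.
From HB Require Import structures.
From mathcomp Require Import all_boot all_order all_algebra.
From mathcomp Require Import complex.
From mathcomp Require Import all_classical all_reals all_analysis.
From mathcomp Require Import ring lra zify.

Set Implicit Arguments.
Unset Strict Implicit.
Unset Printing Implicit Defensive.

Import Order.TTheory GRing.Theory Num.Theory.
Import numFieldNormedType.Exports.

Local Open Scope classical_set_scope.
Local Open Scope ring_scope.
Local Open Scope complex_scope.

(** The denominator is [x u + U] and the numerator is [2 (x v + V)], where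
    [u = J_0 (2 sqrt y)] and [v = Y_0 (2 sqrt y)] are two solutions of
    [y u'' + u' + u = 0], and [U = y u'], [V = y v'].  The differential equation
    says that [U' = - u] and [V' = - v], and with it the numerator of the
    differential of the quotient becomes
    [2 W (- y dx + (x ^ 2 + y) dy) / y], where [W = u V - v U].  So everything
    reduces to the Wronskian [W] being a non-zero constant: the quotient is a first
    integral, it is not constant because for a fixed [y] it is a homography in [x]
    of determinant [W], and the numerator and the denominator have no common zero
    ([hill_jets], [hill_F_jet], [hill_F_nonconstant]).

    The equation for [v] has to be extracted from the definition of [Y_n] as a limit
    over the order.  The reciprocal of Gamma near a nonnegative integer is expressed
    through the function [1 / Gamma (1 + d)] alone, which is differentiable at the origin
    by Weierstrass's product ([recip_GammaE]).  Hence [J] of order [m - 1 + d] is a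
    product of functions differentiable in [d] ([besselJ_order_diff]), the limit
    defining [Y] is a quotient of derivatives ([besselY01]), and
    [v = 2 / pi * ((g + log y / 2) * A_1 + B_1)], where [A_m] and [B_m] are entire
    series [sum_k (-1)^k / k! * c (k + m) * y ^ k].  For these series
    differentiation is [m -> m + 1] with a change of sign, and a recurrence of the
    coefficients gives [A_0 = - y A_2] and [B_0 = A_1 - y B_2]; these identities
    give the two differential equations and show that [pi W / 2] is an entire
    function with zero derivative ([bessel_wronskian], [hill_wronskian]).

    Analyticity is proved with explicit coefficient bounds.  Entire series and the
    logarithm have local expansions ([power_series_analytic1], [clog_analytic1]),
    and functions of two variables with such an expansion are closed under sums,
    products and inverses ([analytic2D], [analytic2M], [analytic2V]).  The linear
    coefficients are recorded along the way, so the same closure properties compute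
    the differential ([analytic2_diff]). *)

(** * The modulus as a real number *)

Section Modulus.
Variable R : realType.
Local Notation C := (CC R).
Implicit Types (z w : C).

(** The norm of [C] takes its values in [C], where the order is partial; the
    estimates below are made in the ordered field [R] instead. *)
Definition cabs z : R := complex.Re `|z|.

Lemma normE z : `|z| = (cabs z)%:C :> C.
Proof. by []. Qed.

Lemma cabs_ge0 z : 0 <= cabs z.
Proof. by rewrite -ler0c -normE normr_ge0. Qed.

Lemma cabsM z w : cabs (z * w) = cabs z * cabs w.
Proof. by apply: complexI; rewrite rmorphM /= -!normE normrM. Qed.

Lemma cabsD z w : cabs (z + w) <= cabs z + cabs w.
Proof. by rewrite -lecR rmorphD /= -!normE ler_normD. Qed.

Lemma cabsN z : cabs (- z) = cabs z.
Proof. by rewrite /cabs normrN. Qed.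

Lemma cabs_distC z w : cabs (z - w) = cabs (w - z).
Proof. by rewrite -cabsN opprB. Qed.

Lemma cabsB z w : cabs (z - w) <= cabs z + cabs w.
Proof. by rewrite -(cabsN w) cabsD. Qed.

Lemma cabs0 : cabs 0 = 0.
Proof. by rewrite /cabs normr0. Qed.

Lemma cabs1 : cabs 1 = 1.
Proof. by rewrite /cabs normr1. Qed.

Lemma cabs_eq0 z : (cabs z == 0) = (z == 0).
Proof. by rewrite -(inj_eq (@complexI R)) -normE normr_eq0. Qed.

Lemma cabs_gt0 z : (0 < cabs z) = (z != 0).
Proof. by rewrite lt_def cabs_ge0 andbT cabs_eq0. Qed.

Lemma cabsX z n : cabs (z ^+ n) = cabs z ^+ n.
Proof. by elim: n => [|n IH]; rewrite ?cabs1// !exprS cabsM IH. Qed.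

Lemma cabsV z : cabs z^-1 = (cabs z)^-1.
Proof.
have [->|z0] := eqVneq z 0; first by rewrite invr0 cabs0 invr0.
apply: (mulfI (x := cabs z)); first by rewrite cabs_eq0.
by rewrite -cabsM !mulfV ?cabs1// cabs_eq0.
Qed.

Lemma cabsR (x : R) : cabs (x%:C : C) = `|x|.
Proof. by rewrite /cabs /= expr0n /= addr0 sqrtr_sqr. Qed.

Lemma cabs_nat n : cabs n%:R = n%:R.
Proof. by rewrite -(rmorph_nat (@real_complex R)) cabsR ger0_norm. Qed.

Lemma cabs_sum (I : Type) (r : seq I) (P : pred I) (F : I -> C) :
  cabs (\sum_(i <- r | P i) F i) <= \sum_(i <- r | P i) cabs (F i).
Proof.
elim/big_ind2 : _ => [|x1 x2 y1 y2 h1 h2|//]; first by rewrite cabs0.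
by rewrite (le_trans (cabsD _ _))// lerD.
Qed.

Lemma cabs_triangle z w : cabs z - cabs w <= cabs (z - w).
Proof. by rewrite lerBlDr -{1}(subrK w z) cabsD. Qed.

Lemma Re_le_cabs z : `|complex.Re z| <= cabs z.
Proof.
by case: z => a b; rewrite /cabs /= -sqrtr_sqr ler_sqrt ?lerDl ?addr_ge0 ?sqr_ge0.
Qed.

Lemma Im_le_cabs z : `|complex.Im z| <= cabs z.
Proof.
by case: z => a b; rewrite /cabs /= -sqrtr_sqr ler_sqrt ?lerDr ?addr_ge0 ?sqr_ge0.
Qed.

Lemma cabs_le_ReIm z : cabs z <= `|complex.Re z| + `|complex.Im z|.
Proof.
case: z => a b; rewrite /cabs /=.
rewrite -(ler_sqr (x := Num.sqrt _)) ?nnegrE ?sqrtr_ge0 ?addr_ge0//.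
rewrite sqr_sqrtr ?addr_ge0 ?sqr_ge0// sqrrD !real_normK ?num_real//.
by rewrite lerD2r lerDl mulrn_wge0// mulr_ge0.
Qed.

Lemma ReD z w : complex.Re (z + w) = complex.Re z + complex.Re w.
Proof. by case: z w => ? ? []. Qed.

Lemma ImD z w : complex.Im (z + w) = complex.Im z + complex.Im w.
Proof. by case: z w => ? ? []. Qed.

Lemma ReN z : complex.Re (- z) = - complex.Re z.
Proof. by case: z. Qed.

Lemma ImN z : complex.Im (- z) = - complex.Im z.
Proof. by case: z. Qed.

Lemma posC_real (x : C) : 0 < x -> exists2 r : R, 0 < r & x = r%:C.
Proof.
by case: x => a b; rewrite ltcE /= => /andP[/eqP -> a0]; exists a.
Qed.

Lemma norm_ltC z w (r : R) : (`|z - w| < r%:C) = (cabs (w - z) < r).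
Proof. by rewrite normE ltcR cabs_distC. Qed.

Lemma cvg_cabs (T : Type) (F : set_system T) (u : T -> C) (l : C) :
  Filter F -> (fun x => cabs (u x - l)) @ F --> (0 : R) <-> u @ F --> l.
Proof.
move=> FF; split=> [/cvgrPdist_lt h|/cvgrPdist_lt h]; apply/cvgrPdist_lt.
  move=> e /posC_real[r r0 ->]; apply: filterS (h _ r0) => x.
  rewrite sub0r normrN ger0_norm ?cabs_ge0// => hx.
  by have := norm_ltC l (u x) r; rewrite hx.
move=> e e0; have /h : (0 : C) < e%:C by rewrite ltcR.
apply: filterS => x hx; rewrite sub0r normrN (ger0_norm (cabs_ge0 _)).
by have := norm_ltC l (u x) e; rewrite hx => /esym.
Qed.

Lemma cvg_cabs_le (T : Type) (F : set_system T) (FF : Filter F)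
    (u : T -> C) (l : C) (b : T -> R) :
  (\forall x \near F, cabs (u x - l) <= b x) -> b @ F --> 0 -> u @ F --> l.
Proof.
move=> ub b0; apply/cvg_cabs; apply: (squeeze_cvgr _ _ b0); last exact: cvg_cst.
by apply: filterS ub => x ->; rewrite cabs_ge0.
Qed.

Lemma cvg_cabs_norm (T : Type) (F : set_system T) (FF : ProperFilter F)
    (u : T -> C) (l : C) : u @ F --> l -> (fun x => cabs (u x)) @ F --> cabs l.
Proof.
move=> /cvg_cabs h; apply/cvgrPdist_le => e e0.
move/cvgrPdist_le : h => /(_ _ e0); apply: filterS => x.
rewrite sub0r normrN ger0_norm ?cabs_ge0// => h.
rewrite ler_norml; have := cabs_triangle (u x) l; have := cabs_triangle l (u x).
rewrite (cabs_distC l); lra.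
Qed.

End Modulus.

(** * Convergent series of complex numbers *)

Section Series.
Variable R : realType.
Local Notation C := (CC R).
Implicit Types (t s : nat -> C) (l z : C).

(** An inductive type, so that two statements about sums are compared through
    their terms and values and not by unfolding convergence of filters. *)
Variant has_sum t l : Prop := HasSum of series t @ \oo --> l.

Lemma CC_hausdorff : hausdorff_space C.
Proof. exact: norm_hausdorff. Qed.

Lemma has_sum_lim t l : has_sum t l -> lim (series t @ \oo) = l.
Proof. by move=> [h]; apply: cvg_lim => //; exact: CC_hausdorff. Qed.

Lemma has_sum_unique t l1 l2 : has_sum t l1 -> has_sum t l2 -> l1 = l2.
Proof. by move=> /has_sum_lim <- /has_sum_lim <-. Qed.

Lemma cvg_ext (T : Type) (F : set_system T) (U : topologicalType)
  (f g : T -> U) (l : U) : f =1 g -> f @ F --> l -> g @ F --> l.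
Proof. by move=> /funext ->. Qed.

Lemma has_sum_eq t s l : t =1 s -> has_sum t l -> has_sum s l.
Proof. by move=> /funext ->. Qed.

Lemma series_add t s n :
  series (fun k => t k + s k) n = series t n + series s n.
Proof. by rewrite /series/= big_split. Qed.

Lemma series_scale t z n : series (fun k => z * t k) n = z * series t n.
Proof. by rewrite /series/= mulr_sumr. Qed.

Lemma seriesS_l t n : series t n.+1 = t 0%N + series (fun k => t k.+1) n.
Proof. by rewrite /series/= big_nat_recl. Qed.

Lemma series_behead t n :
  series (fun k => t k.+1) n = series t n.+1 - t 0%N.
Proof. by rewrite seriesS_l addrAC subrr add0r. Qed.

Lemma has_sumD t s l1 l2 : has_sum t l1 -> has_sum s l2 ->
  has_sum (fun n => t n + s n) (l1 + l2).
Proof.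
move=> [h1] [h2]; split; apply: cvg_ext (cvgD h1 h2) => n.
exact/esym/series_add.
Qed.

Lemma has_sumZ t l z : has_sum t l -> has_sum (fun n => z * t n) (z * l).
Proof.
move=> [h]; split; apply: cvg_ext (cvgM (cvg_cst z) h) => n.
exact/esym/series_scale.
Qed.

Lemma has_sumB t s l1 l2 : has_sum t l1 -> has_sum s l2 ->
  has_sum (fun n => t n - s n) (l1 - l2).
Proof.
move=> h1 h2; have := has_sumD h1 (@has_sumZ _ _ (- 1) h2); rewrite mulN1r.
by apply: has_sum_eq => n; rewrite mulN1r.
Qed.

Lemma has_sum_behead t l :
  has_sum t l -> has_sum (fun n => t n.+1) (l - t 0%N).
Proof.
move=> [h]; rewrite -cvg_shiftS in h; split.
apply: cvg_ext (cvgB h (cvg_cst (t 0%N))) => n.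
exact/esym/series_behead.
Qed.

Lemma has_sum_cons t l :
  has_sum (fun n => t n.+1) l -> has_sum t (t 0%N + l).
Proof.
move=> [h]; split; rewrite -cvg_shiftS.
by apply: cvg_ext (cvgD (cvg_cst (t 0%N)) h) => n; exact/esym/seriesS_l.
Qed.

(** Real and imaginary parts reduce completeness of the plane to that of the
    line. *)
Lemma dominated_has_sum t (b : nat -> R) : (forall n, cabs (t n) <= b n) ->
  cvg (series b @ \oo) -> exists2 l, has_sum t l & cabs l <= lim (series b @ \oo).
Proof.
move=> tb cb.
have part (p : nat -> R) : (forall n, `|p n| <= b n) -> cvg (series p @ \oo).
  move=> pb; apply: normed_cvg; apply: series_le_cvg cb => n //=.
  exact: le_trans (pb n).
have /part cRe : forall n, `|complex.Re (t n)| <= b n.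
  by move=> n; exact: le_trans (Re_le_cabs _) (tb n).
have /part cIm : forall n, `|complex.Im (t n)| <= b n.
  by move=> n; exact: le_trans (Im_le_cabs _) (tb n).
set a := lim _ in cRe; set c := lim _ in cIm.
have sRe n : complex.Re (series t n) = series (fun n => complex.Re (t n)) n.
  by elim: n => [|n]; rewrite /series/= ?big_nil// !big_nat_recr //= ReD => ->.
have sIm n : complex.Im (series t n) = series (fun n => complex.Im (t n)) n.
  by elim: n => [|n]; rewrite /series/= ?big_nil// !big_nat_recr //= ImD => ->.
have tl : has_sum t (a +i* c).
  split; apply: (@cvg_cabs_le _ _ _ _ _ _ (fun n =>
      `|series (fun n => complex.Re (t n)) n - a| + `|series (fun n => complex.Im (t n)) n - c|)).
    apply: nearW => n; apply: le_trans (cabs_le_ReIm _) _.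
    by rewrite ReD ReN ImD ImN sRe sIm.
  rewrite -[0 in X in _ --> X]addr0; apply: cvgD.
    rewrite -(normr0 R) -(subrr a); apply: cvg_norm; apply: cvgB => //; exact: cvg_cst.
  rewrite -(normr0 R) -(subrr c); apply: cvg_norm; apply: cvgB => //; exact: cvg_cst.
exists (a +i* c) => //.
have cl : (fun n => cabs (series t n)) @ \oo --> cabs (a +i* c).
  by case: tl => tl; exact: cvg_cabs_norm tl.
rewrite -(cvg_lim _ cl)//; apply: ler_lim => //; first exact: cvgP cl.
apply: nearW => n; rewrite /series/=.
by apply: le_trans (cabs_sum _ _ _) _; apply: ler_sum => i _.
Qed.

Lemma geometric_has_sum t (M q : R) : 0 <= q < 1 ->
  (forall n, cabs (t n) <= M * q ^+ n) ->
  exists2 l, has_sum t l & cabs l <= M / (1 - q).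
Proof.
move=> /andP[q0 q1] tb.
have q1' : `|q| < 1 by rewrite ger0_norm.
have h := @cvg_geometric_series R M q q1'.
have [l tl ll] := dominated_has_sum tb (cvgP _ h).
by exists l => //; rewrite -(cvg_lim _ h).
Qed.

Lemma has_sum_le t l (M q : R) : 0 <= q < 1 ->
  (forall n, cabs (t n) <= M * q ^+ n) -> has_sum t l -> cabs l <= M / (1 - q).
Proof.
move=> q01 tb tl; have [l' tl'] := geometric_has_sum q01 tb.
by rewrite (has_sum_unique tl tl').
Qed.

Lemma has_sum_drop t l N : has_sum t l ->
  has_sum (fun n => t (n + N)%N) (l - series t N).
Proof.
move=> h; elim: N => [|N IH].
  have -> : series t 0 = 0 by rewrite /series/= big_nil.
  by rewrite subr0; apply: has_sum_eq h => n; rewrite addn0.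
have -> : l - series t N.+1 = l - series t N - t (0 + N)%N.
  by rewrite /series/= big_nat_recr//= opprD addrA.
by apply: has_sum_eq (has_sum_behead IH) => n; rewrite addSnnS.
Qed.

(** All remainders of series below are controlled by this geometric tail. *)
Lemma has_sum_tail t l (M q : R) N : 0 <= q < 1 ->
  (forall n, cabs (t n) <= M * q ^+ n) -> has_sum t l ->
  cabs (l - series t N) <= M * q ^+ N / (1 - q).
Proof.
move=> q01 tb tl; have tl' := @has_sum_drop _ _ N tl.
have tb' n : cabs (t (n + N)%N) <= M * q ^+ N * q ^+ n.
  by rewrite -mulrA -exprD addnC; exact: tb.
exact: has_sum_le q01 tb' tl'.
Qed.

Lemma has_sum_finite t N : (forall n, (N <= n)%N -> t n = 0) ->
  has_sum t (series t N).
Proof.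
move=> t0; split; apply: cvg_near_cst.
exists N => // n /= Nn; rewrite /series/= (big_cat_nat _ Nn)//=.
rewrite [X in _ + X]big_nat_cond [X in _ + X]big1 ?addr0// => i /andP[/andP[h _] _].
exact: t0.
Qed.

End Series.

(** * Complex derivatives with a quadratic remainder *)

Section Derivative.
Variable R : realType.
Local Notation C := (CC R).
Implicit Types (f g : C -> C) (x y z h : C).

(** The functions to be differentiated are analytic, so their remainder is
    quadratic; requiring this turns the rules of differentiation into
    inequalities without limits. *)
Definition cdiff f x (b : C) := exists K r : R, [/\ 0 <= K, 0 < r &
  forall h, cabs h < r -> cabs (f (x + h) - f x - b * h) <= K * cabs h ^+ 2].

Lemma cdiff_cst (c : C) x : cdiff (fun=> c) x 0.
Proof.
exists 0, 1; split=> // h _.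
by rewrite subrr mul0r subrr cabs0 mul0r.
Qed.

Lemma cdiff_linear (c d : C) x : cdiff (fun y => c * y + d) x c.
Proof.
exists 0, 1; split=> // h _; rewrite mul0r.
by rewrite [X in cabs X](_ : _ = 0) ?cabs0//; ring.
Qed.

Lemma cdiff_ext f g x b : f =1 g -> cdiff f x b -> cdiff g x b.
Proof. by move=> /funext ->. Qed.

Lemma cdiff_near f g x b (r : R) : 0 < r ->
  (forall h, cabs h < r -> f (x + h) = g (x + h)) -> cdiff f x b -> cdiff g x b.
Proof.
move=> r0 fg [K [s [K0 s0 hf]]]; exists K, (Num.min r s).
split=> [//||h]; first by rewrite lt_min r0.
rewrite lt_min => /andP[hr hs]; rewrite -fg//.
have -> : g x = f x by have := fg 0; rewrite addr0 cabs0 => ->.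
exact: hf.
Qed.

(** The first-order increment is Lipschitz at [x]; it is what products and
    composites of expansions are estimated with. *)
Lemma cdiff_increment f x b (K : R) h : 0 <= K -> cabs h < 1 ->
  cabs (f (x + h) - f x - b * h) <= K * cabs h ^+ 2 ->
  cabs (f (x + h) - f x) <= (cabs b + K) * cabs h.
Proof.
move=> K0 h1 e; rewrite -(subrK (b * h) (f (x + h) - f x)).
apply: le_trans (cabsD _ _) _; rewrite mulrDl addrC cabsM lerD2l.
apply: le_trans e _; rewrite ler_wpM2l// expr2 ler_piMl ?cabs_ge0//.
exact: ltW.
Qed.

Lemma cdiffD f g x b c :
  cdiff f x b -> cdiff g x c -> cdiff (fun y => f y + g y) x (b + c).
Proof.
move=> [K [r [K0 r0 hf]]] [L [s [L0 s0 hg]]]; exists (K + L), (Num.min r s).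
split=> [||h]; [exact: addr_ge0|by rewrite lt_min r0|].
rewrite lt_min => /andP[/hf ef /hg eg].
rewrite [X in cabs X](_ : _ =
  (f (x + h) - f x - b * h) + (g (x + h) - g x - c * h)); last by ring.
by apply: le_trans (cabsD _ _) _; rewrite mulrDl; apply: lerD.
Qed.

Lemma cdiffM f g x b c : cdiff f x b -> cdiff g x c ->
  cdiff (fun y => f y * g y) x (f x * c + g x * b).
Proof.
move=> [K [r [K0 r0 hf]]] [L [s [L0 s0 hg]]].
exists (cabs (f x) * L + cabs (g x) * K + (cabs b + K) * (cabs c + L)).
exists (Num.min 1 (Num.min r s)).
split=> [||h]; [|by rewrite !lt_min r0 s0 ltr01|].
  by rewrite !addr_ge0 ?mulr_ge0 ?addr_ge0 ?cabs_ge0.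
rewrite !lt_min => /and3P[h1 /hf ef /hg eg].
rewrite [X in cabs X](_ : _ = f x * (g (x + h) - g x - c * h)
  + g x * (f (x + h) - f x - b * h)
  + (f (x + h) - f x) * (g (x + h) - g x)); last by ring.
apply: le_trans (cabsD _ _) _; rewrite [leRHS]mulrDl; apply: lerD.
  apply: le_trans (cabsD _ _) _; rewrite [leRHS]mulrDl !cabsM -!mulrA.
  by apply: lerD; rewrite ler_wpM2l ?cabs_ge0.
rewrite cabsM expr2 mulrACA ler_pM ?cabs_ge0//.
  exact: cdiff_increment ef.
exact: cdiff_increment eg.
Qed.

Lemma cdiffZ f x b (k : C) : cdiff f x b -> cdiff (fun y => k * f y) x (k * b).
Proof.
move=> hf; have := cdiffM (cdiff_cst k x) hf.
by rewrite mulr0 addr0.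
Qed.

Lemma cdiffB f g x b c :
  cdiff f x b -> cdiff g x c -> cdiff (fun y => f y - g y) x (b - c).
Proof.
move=> hf hg; rewrite -[- c]mulN1r.
apply: cdiff_ext (cdiffD hf (cdiffZ (- 1) hg)) => y; by rewrite mulN1r.
Qed.

Lemma cdiff_comp f g x b c : cdiff f x b -> cdiff g (f x) c ->
  cdiff (fun y => g (f y)) x (c * b).
Proof.
move=> [K [r [K0 r0 hf]]] [L [s [L0 s0 hg]]].
pose B := cabs b + K + 1.
have B0 : 0 < B by rewrite ltr_wpDl// addr_ge0 ?cabs_ge0.
exists (cabs c * K + L * B ^+ 2), (Num.min 1 (Num.min r (s / B))).
split=> [||h]; [|by rewrite !lt_min r0 ltr01 divr_gt0|].
  by rewrite !addr_ge0 ?mulr_ge0 ?exprn_ge0 ?cabs_ge0// ltW.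
rewrite !lt_min ltr_pdivlMr// => /and3P[h1 /hf ef hs].
have inc : cabs (f (x + h) - f x) <= B * cabs h.
  have inc0 := cdiff_increment K0 h1 ef; apply: (le_trans inc0).
  by rewrite ler_wpM2r ?cabs_ge0// lerDl.
rewrite mulrC in hs; have := hg _ (le_lt_trans inc hs).
rewrite [f x + _]addrC subrK => eg.
rewrite [X in cabs X](_ : _ = c * (f (x + h) - f x - b * h) +
  (g (f (x + h)) - g (f x) - c * (f (x + h) - f x))); last by ring.
apply: le_trans (cabsD _ _) _; rewrite mulrDl cabsM; apply: lerD.
  by rewrite -mulrA ler_wpM2l ?cabs_ge0.
apply: le_trans eg _; rewrite -mulrA ler_wpM2l// -exprMn.
by rewrite lerXn2r ?nnegrE ?cabs_ge0// mulr_ge0 ?cabs_ge0// ltW.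
Qed.

Lemma cdiff_shift f x y b : cdiff (fun z => f (y + z)) x b <-> cdiff f (y + x) b.
Proof.
by split=> -[K [r [K0 r0 h]]]; exists K, r; split=> // z /h; rewrite addrA.
Qed.

Lemma cvg_near_eq (T : Type) (F : set_system T) (U : topologicalType)
    (u v : T -> U) (l : U) : Filter F ->
  (\forall t \near F, u t = v t) -> u @ F --> l -> v @ F --> l.
Proof. by move=> FF uv; apply: cvg_trans; exact: near_eq_cvg. Qed.

(** Zeros of the numerator and denominator cancel: both increments are linear
    up to a quadratic error. *)
Lemma cdiff_quotient f g x b c : c != 0 -> f x = 0 -> g x = 0 ->
  cdiff f x b -> cdiff g x c -> (fun y => f y / g y) @ x^' --> b / c.
Proof.
move=> c0 fx0 gx0 [K [r [K0 r0 hf]]] [L [s [L0 s0 hg]]].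
have cp : 0 < cabs c by rewrite cabs_gt0.
have slope p q (M t : R) : 0 < t -> p x = 0 ->
    (forall h, cabs h < t -> cabs (p (x + h) - p x - q * h) <= M * cabs h ^+ 2) ->
    (fun y : C => p y / (y - x)) @ x^' --> q.
  move=> t0 px0 hp.
  apply: (@cvg_cabs_le _ _ _ _ _ _ (fun y => M * cabs (y - x))).
    near=> y; have yx : y - x != 0.
      by rewrite subr_eq0; near: y; exact: nbhs_dnbhs_neq.
    have ty : cabs (y - x) < t.
      near: y; apply: nbhs_dnbhs.
      apply/nbhs_ballP; exists (t%:C) => /=; first by rewrite ltcR.
      by move=> y /=; rewrite /ball/= norm_ltC.
    have := hp _ ty; rewrite [x + _]addrC subrK px0 subr0 => e.
    rewrite -(ler_pM2r (_ : 0 < cabs (y - x))) ?cabs_gt0// -cabsM mulrBl divfK//.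
    by rewrite -mulrA -expr2.
  rewrite -[0 in X in _ --> X](mulr0 M); apply: cvgM; first exact: cvg_cst.
  apply/cvg_cabs; apply: cvg_trans (cvg_app _ (@nbhs_dnbhs _ _)) _.
  exact: cvg_id.
have h1 := slope _ _ _ _ r0 fx0 hf.
have h2 := slope _ _ _ _ s0 gx0 hg.
apply: cvg_near_eq (cvgM h1 (cvgV c0 h2)).
near=> y; have yx : y - x != 0.
  by rewrite subr_eq0; near: y; exact: nbhs_dnbhs_neq.
by rewrite /GRing.mul_fun /= invf_div mulrA divfK.
Unshelve. all: by end_near. Qed.

(** Along the segment from the base point, real and imaginary parts have zero
    derivative, and the mean value theorem applies. *)
Lemma cdiff0_cst f (x z : C) :
  (forall t : R, 0 <= t <= 1 -> cdiff f (x + t%:C * z) 0) -> f (x + z) = f x.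
Proof.
move=> hf.
have part (p : C -> R) : (forall u v, p (u - v) = p u - p v) ->
    (forall u, `|p u| <= cabs u) -> p (f (x + z)) = p (f x).
  move=> pB ple; pose phi (t : R) := p (f (x + t%:C * z)).
  have dphi (t : R) : 0 <= t <= 1 -> is_derive t 1 phi 0.
    move=> /hf [K [r [K0 r0 h]]].
    suff : (fun h : R => h^-1 *: ((phi \o shift t) (h *: 1) - phi t)) @ 0^' --> (0 : R).
      move=> c; apply: DeriveDef; first by apply/cvg_ex; exists 0.
      exact: cvg_lim c.
    apply/cvgrPdist_le => e e0.
    have B0 : 0 < 1 + cabs z by rewrite ltr_pwDl ?cabs_ge0.
    have D0 : 0 < 1 + K * (1 + cabs z) ^+ 2.
      by rewrite ltr_pwDl// mulr_ge0// exprn_ge0// ltW.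
    near=> s; rewrite sub0r normrN /phi/= -pB.
    have s0 : s != 0 by near: s; exact: nbhs_dnbhs_neq.
    rewrite normrM normfV ler_pdivrMl ?normr_gt0//.
    rewrite (le_trans (ple _))//.
    have -> : x + (s *: 1 + t)%:C * z = x + t%:C * z + s%:C * z.
      by rewrite rmorphD /= mulrDl /GRing.scale /= mulr1 addrAC addrA addrAC.
    have := h (s%:C * z); rewrite cabsM cabsR mul0r subr0.
    have sr : `|s| < r / (1 + cabs z).
      by near: s; apply: dnbhs0_lt; exact: divr_gt0.
    have se : `|s| < e / (1 + K * (1 + cabs z) ^+ 2).
      by near: s; apply: dnbhs0_lt; exact: divr_gt0.
    move: sr se; rewrite !ltr_pdivlMr// => sr se.
    have zB : cabs z <= 1 + cabs z by rewrite lerDr.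
    rewrite (le_lt_trans _ sr) ?ler_wpM2l// => /(_ isT) hh.
    rewrite (le_trans hh)// exprMn mulrCA expr2 -mulrA ler_wpM2l//.
    apply: le_trans (ltW se); rewrite ler_wpM2l//.
    apply: le_trans (_ : K * (1 + cabs z) ^+ 2 <= _); last by rewrite lerDr.
    by rewrite ler_wpM2l// lerXn2r ?nnegrE ?cabs_ge0// ltW.
  have [||c _] := @MVT_segment R phi (fun=> 0) 0 1 ler01.
  - by move=> t /[!in_itv]/= /andP[t0 t1]; apply: dphi; rewrite !ltW.
  - apply: continuous_in_subspaceT => t /[!inE]/= /[!in_itv]/= t01.
    apply/differentiable_continuous/derivable1_diffP.
    exact: (@ex_derive _ _ _ _ _ _ _ (dphi t t01)).
  rewrite mul0r => /eqP; rewrite subr_eq0 /phi => /eqP.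
  by rewrite mul1r mul0r addr0.
have hRe : complex.Re (f (x + z)) = complex.Re (f x).
  by apply: part => [u v|u]; [rewrite ReD ReN|exact: Re_le_cabs].
have hIm : complex.Im (f (x + z)) = complex.Im (f x).
  by apply: part => [u v|u]; [rewrite ImD ImN|exact: Im_le_cabs].
by move: hRe hIm; case: (f _) (f _) => a b [c d] /= -> ->.
Unshelve. all: by end_near. Qed.

End Derivative.

(** * Power series in one variable *)

Section PowerSeries.
Variable R : realType.
Local Notation C := (CC R).
Implicit Types (f : C -> C) (c b : nat -> C) (y z h : C).

(** The derivative [d] is part of the statement: it is the coefficient of degree
    one. *)
Definition analytic1 f y (d : C) := exists (b : nat -> C) (r M : R),
  [/\ 0 < r, b 1%N = d, forall j, cabs (b j) * r ^+ j <= M &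
    forall h, cabs h < r -> has_sum (fun j => b j * h ^+ j) (f (y + h))].

Lemma coef_bound_ge0 c (r M : R) :
  (forall j, cabs (c j) * r ^+ j <= M) -> 0 <= M.
Proof. by move=> /(_ 0%N); apply: le_trans; rewrite mulr1 cabs_ge0. Qed.

Lemma term_bound (a h : C) (r M : R) j : 0 < r -> cabs a * r ^+ j <= M ->
  cabs (a * h ^+ j) <= M * (cabs h / r) ^+ j.
Proof.
move=> r0 aM; rewrite cabsM cabsX exprMn exprVn mulrCA mulrC.
rewrite ler_wpM2l ?exprn_ge0 ?cabs_ge0//.
by rewrite ler_pdivlMr// exprn_gt0.
Qed.

Lemma ratio_lt1 (h : C) (r : R) : 0 < r -> cabs h < r -> 0 <= cabs h / r < 1.
Proof.
move=> r0 hr; rewrite divr_ge0 ?cabs_ge0// ?(ltW r0)//=.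
by rewrite ltr_pdivrMr// mul1r.
Qed.

Lemma analytic1_cdiff f y d : analytic1 f y d -> cdiff f y d.
Proof.
move=> [b [r [M [r0 bd bM fs]]]].
have M0 := coef_bound_ge0 bM.
have f0 : f y = b 0%N.
  have := fs 0; rewrite cabs0 addr0 => /(_ r0) h1.
  have z n : (1 <= n)%N -> b n * 0 ^+ n = 0.
    by case: n => // n _; rewrite expr0n mulr0.
  rewrite (has_sum_unique h1 (has_sum_finite z)).
  by rewrite /series/= big_nat1 expr0 mulr1.
(* For [cabs h < r / 2] the ratio of the tail is at most [1 / 2], whence the
   factor [2]. *)
exists (M * (r ^- 2) * 2), (r / 2); split=> [||h hr]; last 1 first.
- have hr' : cabs h < r by apply: lt_trans hr _; rewrite ltr_pdivrMr//; lra.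
  have := @has_sum_tail _ _ _ _ _ 2 (ratio_lt1 r0 hr')
    (fun n => term_bound h r0 (bM n)) (fs h hr').
  rewrite /series/= big_nat_recr//= big_nat1 expr0 mulr1 expr1 bd f0 opprD addrA.
  move=> /le_trans; apply.
  have q2 : cabs h / r <= 2^-1 by rewrite ler_pdivrMr// mulrC ltW.
  have -> : M * r ^- 2 * 2 * cabs h ^+ 2 = M * (cabs h / r) ^+ 2 * 2.
    by rewrite exprMn exprVn; ring.
  rewrite ler_wpM2l ?mulr_ge0 ?exprn_ge0 ?divr_ge0 ?invr_ge0 ?cabs_ge0 ?(ltW r0)//.
  rewrite -[leRHS]invrK lef_pV2 ?posrE; lra.
- by rewrite !mulr_ge0 ?invr_ge0 ?exprn_ge0 ?(ltW r0).
- by rewrite divr_gt0.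
Qed.

Lemma binomial_term_le (y r : R) k j : 0 <= y -> 0 <= r ->
  'C(k, j)%:R * y ^+ (k - j) * r ^+ j <= (y + r) ^+ k.
Proof.
move=> y0 r0; have [kj|jk] := ltnP k j.
  by rewrite bin_small// !mul0r exprn_ge0// addr_ge0.
rewrite exprDn (bigD1 (Ordinal (jk : (j < k.+1)%N)))//= -mulrA mulr_natl.
by rewrite lerDl sumr_ge0// => i _; rewrite mulrn_wge0// mulr_ge0 ?exprn_ge0.
Qed.

(** A power series is re-expanded around any point of its disc of convergence
    by exchanging two sums.  The exchange is exact on the first [N] terms of the
    series, and what is left over is a geometric tail in each coefficient. *)
Lemma power_series_analytic1 f c y (r M : R) : 0 < r ->
  (forall k, cabs (c k) * r ^+ k <= M) ->
  (forall z, cabs z < r -> has_sum (fun k => c k * z ^+ k) (f z)) ->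
  cabs y < r ->
  exists2 d, has_sum (fun k => k.+1%:R * c k.+1 * y ^+ k) d & analytic1 f y d.
Proof.
move=> r0 cM fs yr.
have M0 := coef_bound_ge0 cM.
(* Half the distance to the boundary: [cabs y + s] is still smaller than [r]. *)
pose s := (r - cabs y) / 2.
have s0 : 0 < s by rewrite divr_gt0// subr_gt0.
pose q := (cabs y + s) / r.
have q01 : 0 <= q < 1.
  rewrite divr_ge0 ?addr_ge0 ?cabs_ge0 ?(ltW s0) ?(ltW r0)//=.
  by rewrite ltr_pdivrMr// mul1r /s; lra.
have /andP[q0 q1] := q01.
pose t j k : C := 'C(k, j)%:R * c k * y ^+ (k - j).
have tb j k : cabs (t j k) * s ^+ j <= M * q ^+ k.
  have bt := binomial_term_le k j (cabs_ge0 y) (ltW s0).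
  have -> : cabs (t j k) * s ^+ j =
      cabs (c k) * ('C(k, j)%:R * cabs y ^+ (k - j) * s ^+ j).
    by rewrite !cabsM cabs_nat cabsX; ring.
  apply: le_trans (ler_wpM2l (cabs_ge0 _) bt) _.
  have -> : M * q ^+ k = M / r ^+ k * (cabs y + s) ^+ k.
    by rewrite /q exprMn exprVn; ring.
  rewrite ler_wpM2r ?exprn_ge0 ?addr_ge0 ?cabs_ge0 ?(ltW s0)//.
  by rewrite ler_pdivlMr ?exprn_gt0.
have tb' j k : cabs (t j k) <= M / s ^+ j * q ^+ k.
  by rewrite mulrAC ler_pdivlMr ?exprn_gt0.
have [b bt] : {b : nat -> C & forall j, has_sum (t j) (b j)}.
  apply: (@choice _ _ (fun j l => has_sum (t j) l)) => j.
  by have [l] := geometric_has_sum q01 (tb' j); exists l.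
exists (b 1%N).
  have := has_sum_behead (bt 1%N); rewrite {2}/t bin0n mul0r mul0r subr0.
  by apply: has_sum_eq => k; rewrite /t bin1 subn1.
exists b, s, (M / (1 - q)); split=> // [j|h hs].
  have := has_sum_le q01 (tb' j) (bt j).
  by rewrite mulrAC ler_pdivlMr// exprn_gt0.
have yhr : cabs (y + h) < r.
  apply: le_lt_trans (cabsD _ _) _.
  by apply: lt_le_trans (_ : cabs y + s <= _); rewrite ?ltrD2l// /s; lra.
(* A binomial coefficient vanishes for [j > k], so both indices may run up to
   [N]. *)
have xchg N : series (fun k => c k * (y + h) ^+ k) N =
    \sum_(0 <= j < N) series (t j) N * h ^+ j.
  rewrite /series/= [RHS](_ : _ = \sum_(0 <= j < N) \sum_(0 <= k < N) t j k * h ^+ j); last first.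
    by apply: eq_bigr => j _; rewrite mulr_suml.
  rewrite exchange_big_nat/=; apply: eq_big_nat => k /andP[_ kN].
  rewrite exprDn mulr_sumr big_mkord.
  rewrite (big_ord_widen N (fun j => c k * (y ^+ (k - j) * h ^+ j *+ 'C(k, j))))//.
  rewrite big_mkcond/=; apply: eq_bigr => j _; case: ltnP => [_|kj].
    by rewrite /t -mulr_natl; ring.
  by rewrite /t bin_small// !mul0r.
pose p := cabs h / s.
have /andP[p0 p1] : 0 <= p < 1 := ratio_lt1 s0 hs.
pose B := M / (1 - q) / (1 - p).
have key N : cabs (series (fun j => b j * h ^+ j) N
    - series (fun k => c k * (y + h) ^+ k) N) <= B * q ^+ N.
  rewrite xchg /series/= -sumrB.
  apply: le_trans (cabs_sum _ _ _) _.
  apply: (@le_trans _ _ (\sum_(0 <= j < N) M / (1 - q) * q ^+ N * p ^+ j)).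
    apply: ler_sum => j _; rewrite -mulrBl cabsM cabsX.
    have := has_sum_tail N q01 (tb' j) (bt j).
    move=> /(ler_wpM2r (exprn_ge0 j (cabs_ge0 h))) /le_trans; apply.
    have -> : p ^+ j = cabs h ^+ j * s ^- j by rewrite /p -exprVn -exprMn.
    by rewrite le_eqVlt; apply/orP; left; apply/eqP; ring.
  rewrite -mulr_sumr.
  have -> : B * q ^+ N = M / (1 - q) * q ^+ N * (1 - p)^-1 by rewrite /B; ring.
  apply: ler_wpM2l.
    by rewrite !mulr_ge0 ?invr_ge0 ?exprn_ge0 ?subr_ge0 ?(ltW q1).
  rewrite -[leRHS]mul1r ler_pdivlMr ?subr_gt0//.
  have -> : (\sum_(0 <= j < N) p ^+ j) * (1 - p) = 1 - p ^+ N.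
    elim: (N) => [|n IH]; first by rewrite big_nil mul0r expr0 subrr.
    by rewrite big_nat_recr//= mulrDl IH exprS; ring.
  by rewrite gerBl exprn_ge0.
split; have [/cvg_cabs hf] := fs _ yhr.
apply: (@cvg_cabs_le _ _ _ _ _ _ (fun N => B * q ^+ N
  + cabs (series (fun k => c k * (y + h) ^+ k) N - f (y + h)))).
  apply: nearW => N; apply: le_trans (lerD (key N) (lexx _)).
  by rewrite -[X in cabs X <= _](subrKA (series (fun k => c k * (y + h) ^+ k) N)) cabsD.
rewrite -[0 in X in _ --> X]addr0; apply: cvgD => //.
rewrite -(mulr0 B); apply: cvgM; first exact: cvg_cst.
by apply: cvg_expr; rewrite ger0_norm.
Qed.

End PowerSeries.

(** * The complex exponential and the branches of the logarithm *)

Section Exponential.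
Variable R : realType.
Local Notation C := (CC R).
Implicit Types (z w : C) (alpha : R).

Lemma cexpE (a b : R) : cexp (a +i* b : C) = (expR a * cos b) +i* (expR a * sin b).
Proof. by rewrite /cexp /=; apply/eqP; rewrite eq_complex /= !mul0r subr0 addr0 !eqxx. Qed.

Lemma cexp0 : cexp (0 : C) = 1.
Proof. by rewrite -[0 : C]/(0 +i* 0) cexpE expR0 cos0 sin0 mulr1 mulr0. Qed.

Lemma cexpD z w : cexp (z + w) = cexp z * cexp w.
Proof.
case: z w => a b [c d]; rewrite -[_ + _]/((a + c) +i* (b + d)) !cexpE.
rewrite expRD cosD sinD; apply/eqP; rewrite eq_complex /=.
by apply/andP; split; apply/eqP; ring.
Qed.

Lemma cabs_cexp z : cabs (cexp z) = expR (complex.Re z).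
Proof.
case: z => a b; rewrite /cexp cabsM cabsR ger0_norm ?expR_ge0//=.
by rewrite /cabs /= cos2Dsin2 sqrtr1 mulr1.
Qed.

Lemma cexp_neq0 z : cexp z != 0.
Proof. by rewrite -cabs_gt0 cabs_cexp expR_gt0. Qed.

Lemma cexpN z : cexp (- z) = (cexp z)^-1.
Proof.
apply: (mulfI (cexp_neq0 z)).
by rewrite -cexpD subrr cexp0 mulfV ?cexp_neq0.
Qed.

Lemma cexp_real (x : R) : cexp (x%:C : C) = (expR x)%:C.
Proof. by rewrite cexpE cos0 sin0 mulr1 mulr0. Qed.

Lemma cexp_imag (x : R) : cexp ('i * x%:C : C) = cos x +i* sin x.
Proof.
have -> : 'i * x%:C = 0 +i* x :> C.
  by apply/eqP; rewrite eq_complex /= !mul0r !mul1r subr0 add0r !eqxx.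
by rewrite cexpE expR0 !mul1r.
Qed.

Lemma sin_abs_le (x : R) : `|sin x| <= `|x|.
Proof.
wlog x0 : x / 0 <= x.
  move=> h; have [/h //|/ltW x0] := leP 0 x.
  by rewrite -normrN -sinN -(normrN x); apply: h; rewrite oppr_ge0.
have [|c _] := @MVT_segment R sin cos 0 x x0.
  by apply: continuous_subspaceT => t; exact: continuous_sin.
rewrite sin0 !subr0 => ->; rewrite normrM ler_piMl//; exact: cos_max.
Qed.

Lemma cosB1_abs_le (x : R) : `|cos x - 1| <= x ^+ 2.
Proof.
wlog x0 : x / 0 <= x.
  move=> h; have [/h //|/ltW x0] := leP 0 x.
  by rewrite -cosN -sqrrN; apply: h; rewrite oppr_ge0.
have [|c] := @MVT_segment R cos (fun t => - sin t) 0 x x0.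
  by apply: continuous_subspaceT => t; exact: continuous_cos.
rewrite in_itv/= => /andP[c0 cx]; rewrite cos0 subr0 => ->.
rewrite normrM normrN (ger0_norm x0) expr2 ler_wpM2r//.
by apply: le_trans (sin_abs_le _) _; rewrite ger0_norm.
Qed.

Lemma sinBid_abs_le (x : R) : `|x| <= 1 -> `|sin x - x| <= x ^+ 2.
Proof.
wlog x0 : x / 0 <= x.
  move=> h; have [/h //|/ltW x0 x1] := leP 0 x.
  have := h (- x); rewrite oppr_ge0 normrN sqrrN sinN -opprD normrN.
  exact.
rewrite ger0_norm// => x1.
have [|c] := @MVT_segment R (fun t => sin t - t) (fun t => cos t - 1) 0 x x0.
  by apply: continuous_subspaceT => t; apply: cvgB; [exact: continuous_sin|exact: cvg_id].
rewrite in_itv/= => /andP[c0 cx]; rewrite sin0 !subr0 => ->.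
rewrite normrM (ger0_norm x0) expr2 ler_wpM2r//.
apply: le_trans (cosB1_abs_le _) _; rewrite expr2.
nra.
Qed.

Lemma expRB1id_abs_le (x : R) : `|x| <= 2^-1 -> `|expR x - 1 - x| <= 2 * x ^+ 2.
Proof.
rewrite ler_norml => /andP[x1 x2].
have e1 := expR_ge1Dx x; have e2 := expR_ge1Dx (- x).
have p : 0 < expR x := expR_gt0 x.
have e : expR x * expR (- x) = 1 by rewrite expRxMexpNx_1.
have e3 : expR x * (1 - x) <= 1 by rewrite -[leRHS]e ler_wpM2l ?(ltW p)// e2.
rewrite ger0_norm; nra.
Qed.

(** The quadratic remainders of [expR], [cos] and [sin] at the origin, combined
    for the real and the imaginary part. *)
Lemma cdiff_cexp0 : cdiff (@cexp R) 0 1.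
Proof.
exists 9, 2^-1; split=> // h hlt; rewrite cexp0 add0r mul1r.
have := Re_le_cabs h; have := Im_le_cabs h.
move: hlt; set m := cabs h; case: h @m => a b m hlt /= bm am.
have m0 : 0 <= m := cabs_ge0 _.
rewrite cexpE; apply: le_trans (cabs_le_ReIm _) _ => /=.
have h1 : `|a| <= 2^-1 by apply: le_trans am _; exact: ltW.
have h2 : `|b| <= 1 by apply: le_trans bm _; lra.
have ea := expRB1id_abs_le h1; have sb := sinBid_abs_le h2; have cb := cosB1_abs_le b.
have a2 : a ^+ 2 <= m ^+ 2 by rewrite -real_normK ?num_real// lerXn2r ?nnegrE.
have b2 : b ^+ 2 <= m ^+ 2 by rewrite -real_normK ?num_real// lerXn2r ?nnegrE.
have eM : expR a <= 2.
  move: ea h1; rewrite !ler_norml => /andP[_ ea] /andP[_ h1].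
  have : a ^+ 2 <= 4^-1 by nra.
  lra.
have eP : 0 < expR a := expR_gt0 a.
have r1 : `|expR a * cos b - 1 - a| <= 4 * m ^+ 2.
  rewrite (_ : _ - _ = expR a * (cos b - 1) + (expR a - 1 - a)); last by ring.
  apply: le_trans (ler_normD _ _) _; rewrite normrM (gtr0_norm eP).
  have : expR a * `|cos b - 1| <= 2 * b ^+ 2 by rewrite ler_pM// ltW.
  lra.
have r2 : `|expR a * sin b - b| <= 5 * m ^+ 2.
  rewrite (_ : _ - _ = expR a * (sin b - b) + (expR a - 1 - a) * b + a * b); last by ring.
  apply: le_trans (ler_normD _ _) _; apply: le_trans (lerD (ler_normD _ _) (lexx _)) _.
  rewrite !normrM (gtr0_norm eP).
  have : expR a * `|sin b - b| <= 2 * b ^+ 2 by rewrite ler_pM// ltW.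
  have : `|expR a - 1 - a| * `|b| <= 2 * a ^+ 2.
    by apply: le_trans (_ : 2 * a ^+ 2 * 1 <= _); [rewrite ler_pM|rewrite mulr1].
  have : `|a| * `|b| <= m ^+ 2 by rewrite expr2 ler_pM.
  lra.
move: r1 r2; rewrite subr0; lra.
Qed.

Lemma cdiff_cexp z : cdiff (@cexp R) z (cexp z).
Proof.
have [K [r [K0 r0 hK]]] := cdiff_cexp0.
exists (cabs (cexp z) * K), r; split=> //; first by rewrite mulr_ge0 ?cabs_ge0.
move=> h /hK; rewrite add0r cexp0 mul1r => e.
rewrite cexpD (_ : _ - _ = cexp z * (cexp h - 1 - h)); last by ring.
by rewrite cabsM -mulrA ler_wpM2l ?cabs_ge0.
Qed.

(** Where [cos b = 1] one has [sin (b / 2) = 0], which excludes [0 < |b| < 2 pi]: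
    two logarithms of a number in one window of height [2 pi] coincide. *)
Lemma cexp_inj_strip z w : cexp z = cexp w ->
  `|complex.Im z - complex.Im w| < 2 * pi -> z = w.
Proof.
move=> e; apply: contraTeq; rewrite -leNgt -subr_eq0.
have {e} : cexp (z - w) = 1 by rewrite cexpD cexpN e mulfV ?cexp_neq0.
rewrite -ImN -ImD; case: (z - w) => a b /= e ab0; rewrite leNgt; apply: contraNN ab0.
move=> b2; have a0 : a = 0.
  by apply: expR_inj; have := cabs_cexp (a +i* b); rewrite e cabs1 expR0 => /= <-.
move: e; rewrite a0 cexpE expR0 !mul1r => -[cb sb].
have s0 : sin (b / 2) = 0.
  apply/eqP; rewrite -sqrf_eq0; have := cos_mulr2n (b / 2).
  have -> : b / 2 *+ 2 = b by rewrite -mulr_natr divfK.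
  rewrite cb cos2sin2 => h; apply/eqP; move: h; rewrite mulr2n; lra.
suff -> : b = 0 by rewrite eqxx.
move: b2; rewrite ltr_norml => /andP[b1 b2].
have [bp|bn|//] := ltgtP b 0.
- have : 0 < sin (- (b / 2)) by apply: sin_gt0_pi; apply/andP; split; lra.
  by rewrite sinN s0 oppr0 ltxx.
- have : 0 < sin (b / 2) by apply: sin_gt0_pi; apply/andP; split; lra.
  by rewrite s0 ltxx.
Qed.

Lemma cexp_2pi_int (n : int) : cexp ('i * (2 * pi * n%:~R)%:C : C) = 1.
Proof.
have nat_case (m : nat) : cexp ('i * (2 * pi * m%:R)%:C : C) = 1.
  elim: m => [|m IH]; first by rewrite !mulr0 cexp0.
  have -> : 2 * pi * m.+1%:R = 2 * pi * m%:R + pi *+ 2 :> R.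
    by rewrite (mulrSr 1 m); ring.
  by rewrite rmorphD mulrDr cexpD IH cexp_imag cos2pi sin2pi mulr1.
case: n => m; first exact: nat_case.
by rewrite NegzE rmorphN /= mulrN rmorphN mulrN cexpN -pmulrn nat_case invr1.
Qed.

Lemma scale_complexE (m : R) z : m != 0 ->
  m%:C * (complex.Re z / m +i* (complex.Im z / m)) = z :> C.
Proof.
case: z => x y m0; apply/eqP; rewrite eq_complex /= !mul0r subr0 addr0.
by rewrite ![m * _]mulrC !divfK// !eqxx.
Qed.

Lemma cexp_onto z : z != 0 -> exists w, cexp w = z.
Proof.
move=> z0; have r0 : 0 < cabs z by rewrite cabs_gt0.
have rn0 : cabs z != 0 by rewrite gt_eqF.
pose a := complex.Re z / cabs z; pose b := complex.Im z / cabs z.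
have ab : a ^+ 2 + b ^+ 2 = 1.
  rewrite /a /b !expr_div_n -mulrDl.
  have -> : complex.Re z ^+ 2 + complex.Im z ^+ 2 = cabs z ^+ 2.
    by case: (z) => x y; rewrite /cabs /= sqr_sqrtr// addr_ge0 ?sqr_ge0.
  by rewrite mulfV// sqrf_eq0.
have a1 : -1 <= a <= 1 by have := sqr_ge0 b => b2; apply/andP; split; nra.
have ca : cos (acos a) = a by rewrite acosK// in_itv.
have sa : sin (acos a) = `|b|.
  by rewrite sin_acos// -sqrtr_sqr; congr Num.sqrt; lra.
have [t ct st] : exists2 t, cos t = a & sin t = b.
  have [b0|b0] := leP 0 b; first by exists (acos a); rewrite // sa ger0_norm.
  by exists (- acos a); rewrite ?cosN// sinN sa ltr0_norm// opprK.
exists ((ln (cabs z))%:C + 'i * t%:C).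
rewrite cexpD cexp_real cexp_imag lnK ?posrE// ct st /a /b.
exact: scale_complexE.
Qed.

(** A logarithm is moved into the window by an integral multiple of [2 pi i],
    read off from the integral part of the distance of its argument to the upper
    end. *)
Lemma clogP alpha z : z != 0 -> cexp (clog alpha z) = z /\
  alpha - pi < complex.Im (clog alpha z) <= alpha + pi.
Proof.
move=> z0; rewrite /clog; set A := [set w | _].
suff [w Aw] : exists w, A w by apply: (@getPex _ A); exists w.
have [w wz] := cexp_onto z0.
have p0 : 0 < 2 * pi :> R by rewrite mulr_gt0 ?pi_gt0.
pose n := Num.floor ((alpha + pi - complex.Im w) / (2 * pi)).
exists (w + 'i * (2 * pi * n%:~R)%:C); split.
  by rewrite cexpD cexp_2pi_int mulr1.
have := floor_itv ((alpha + pi - complex.Im w) / (2 * pi)).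
rewrite -/n ler_pdivlMr// ltr_pdivrMr// intrD => /andP[h1 h2].
rewrite ImD; have -> : complex.Im ('i * (2 * pi * n%:~R)%:C : C) = 2 * pi * n%:~R.
  by rewrite /= !mul0r mul1r add0r.
by apply/andP; split; lra.
Qed.

Lemma clog_unique alpha w : alpha - pi < complex.Im w <= alpha + pi ->
  clog alpha (cexp w) = w.
Proof.
move=> /andP[w1 w2]; have [e /andP[l1 l2]] := clogP alpha (cexp_neq0 w).
by apply: cexp_inj_strip e _; rewrite ltr_norml; apply/andP; split; lra.
Qed.

Lemma slit_ray0 alpha : slit_ray alpha 0.
Proof. by exists 0 => //; rewrite mul0r. Qed.

Lemma slit_rayP alpha w : alpha - pi < complex.Im w <= alpha + pi ->
  slit_ray alpha (cexp w) <-> complex.Im w = alpha + pi.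
Proof.
move=> hw; split=> [[t t0 e]|wa].
  have {}t0 : 0 < t.
    rewrite lt_def t0 andbT; apply/eqP => tz; move: e; rewrite tz mul0r => /eqP.
    by rewrite (negbTE (cexp_neq0 _)).
  pose v : C := (ln t)%:C + 'i * (alpha + pi)%:C.
  have vE : complex.Im v = alpha + pi by rewrite /v /= !mul0r mul1r !add0r.
  have -> // : w = v.
  apply: cexp_inj_strip; first by rewrite cexpD cexp_real lnK ?posrE.
  have := pi_gt0 R; move: hw => /andP[]; rewrite vE ltr_norml => h1 h2 h3.
  by apply/andP; split; lra.
exists (expR (complex.Re w)); first exact: expR_ge0.
rewrite cexp_imag /cexp -wa; by case: (w).
Qed.

Lemma clog_off_slit alpha y : ~ slit_ray alpha y ->
  [/\ y != 0, cexp (clog alpha y) = y &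
      alpha - pi < complex.Im (clog alpha y) < alpha + pi].
Proof.
move=> ny; have y0 : y != 0.
  by apply/eqP => e; apply: ny; rewrite e; exact: slit_ray0.
have [e /[dup] h /andP[h1 h2]] := clogP alpha y0; split=> //.
rewrite h1 lt_neqAle h2 andbT; apply/eqP => h3; apply: ny.
by rewrite -e; apply/slit_rayP.
Qed.

End Exponential.

(** * Analyticity of the logarithm *)

Section Logarithm.
Variable R : realType.
Local Notation C := (CC R).
Implicit Types (t y z w h : C) (alpha : R).

(** The sum [l] satisfies [l - 1 = q * l]. *)
Lemma geometric_has_sumE (q : C) : cabs q < 1 ->
  has_sum (fun k => q ^+ k) (1 - q)^-1.
Proof.
move=> q1; have q01 : 0 <= cabs q < 1 by rewrite cabs_ge0.
have tb k : cabs (q ^+ k) <= 1 * cabs q ^+ k by rewrite mul1r cabsX.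
have [l hl _] := geometric_has_sum q01 tb.
have h1 := has_sum_behead hl.
have h2 := @has_sumZ _ _ _ q hl.
have e : l - q ^+ 0 = q * l.
  by apply: has_sum_unique h1 _; apply: has_sum_eq h2 => k; rewrite exprS.
have qn1 : 1 - q != 0.
  by rewrite subr_eq0; apply: contraTneq q1 => <-; rewrite cabs1 ltxx.
have <- : l = (1 - q)^-1; last exact: hl.
by apply: (mulfI qn1); rewrite mulfV// mulrBl mul1r -e expr0 opprB addrC subrK.
Qed.

Definition log1p_coef (k : nat) : C := if k is j.+1 then (-1) ^+ j / j.+1%:R else 0.

Lemma log1p_coef_le1 k : cabs (log1p_coef k) <= 1.
Proof.
case: k => [|k]; first by rewrite cabs0.
rewrite cabsM cabsX cabsN cabs1 expr1n mul1r cabsV cabs_nat.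
by rewrite invf_le1 ?ltr0n// ler1n.
Qed.

Definition log1p t : C := lim (series (fun k => log1p_coef k * t ^+ k) @ \oo).

Lemma log1p_has_sum t : cabs t < 1 -> has_sum (fun k => log1p_coef k * t ^+ k) (log1p t).
Proof.
move=> t1; have tb k : cabs (log1p_coef k * t ^+ k) <= 1 * cabs t ^+ k.
  by rewrite cabsM cabsX ler_wpM2r ?exprn_ge0 ?cabs_ge0 ?log1p_coef_le1.
have t01 : 0 <= cabs t < 1 by rewrite cabs_ge0.
have [l hl _] := geometric_has_sum t01 tb.
by rewrite /log1p (has_sum_lim hl).
Qed.

Lemma log1p_analytic1 t : cabs t < 1 -> analytic1 log1p t (1 + t)^-1.
Proof.
move=> t1.
have cM k : cabs (log1p_coef k) * 1 ^+ k <= 1.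
  by rewrite expr1n mulr1 log1p_coef_le1.
have [d hd hA] := power_series_analytic1 ltr01 cM log1p_has_sum t1.
suff <- : d = (1 + t)^-1 by [].
apply: has_sum_unique hd _; rewrite -[in X in has_sum _ X](opprK t).
apply: has_sum_eq (geometric_has_sumE (q := - t) _); last by rewrite cabsN.
by move=> k; rewrite /log1p_coef mulrCA mulfV ?pnatr_eq0// mulr1 -exprMn mulN1r.
Qed.

Lemma log1p0 : log1p 0 = 0.
Proof.
have h0 : cabs (0 : C) < 1 by rewrite cabs0.
have tb k : cabs (log1p_coef k * 0 ^+ k) <= 0 * 0 ^+ k.
  by case: k => [|k]; rewrite ?expr0n ?mul0r ?mulr0 cabs0 ?mul0r.
have q0 : 0 <= (0 : R) < 1 by rewrite lexx ltr01.
have := has_sum_le q0 tb (log1p_has_sum h0).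
by rewrite mul0r => h; apply/eqP; rewrite -cabs_eq0 eq_le h cabs_ge0.
Qed.

(** The function [exp (- log1p u) * (1 + u)] has zero derivative on the unit
    disc and the value [1] at the origin. *)
Lemma cexp_log1p t : cabs t < 1 -> cexp (log1p t) = 1 + t.
Proof.
move=> t1.
pose g u := cexp (- log1p u) * (1 + u).
suff : g t = g 0.
  rewrite /g log1p0 oppr0 cexp0 addr0 mulr1 cexpN => e.
  by rewrite -[LHS]mulr1 -[X in _ * X = _]e mulrA mulfV ?mul1r ?cexp_neq0.
rewrite -[t]add0r; apply: cdiff0_cst => s /andP[s0 s1]; rewrite add0r.
have st : cabs (s%:C * t) < 1.
  by rewrite cabsM cabsR ger0_norm// (le_lt_trans _ t1)// ler_piMl ?cabs_ge0.
have n0 : 1 + s%:C * t != 0.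
  by rewrite addrC addr_eq0; apply: contraTneq st => ->; rewrite cabsN cabs1 ltxx.
have dl := analytic1_cdiff (log1p_analytic1 st).
have de := cdiff_comp (cdiffZ (-1) dl) (cdiff_cexp _).
have := cdiffM de (cdiff_linear 1 1 (s%:C * t)).
set d := (X in cdiff _ _ X); have -> : d = 0 by rewrite /d; field.
by apply: cdiff_ext => u; rewrite /g mulN1r mul1r addrC.
Qed.

Lemma cabs_log1p_le t : cabs t <= 2^-1 -> cabs (log1p t) <= 2 * cabs t.
Proof.
move=> t2; have t1 : cabs t < 1 by lra.
have := has_sum_behead (log1p_has_sum t1); rewrite /= mul0r subr0 => h.
have tb k : cabs ((-1) ^+ k / k.+1%:R * t ^+ k.+1) <= cabs t * cabs t ^+ k.
  have c1 : cabs ((-1) ^+ k / k.+1%:R : C) <= 1 := log1p_coef_le1 k.+1.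
  by rewrite cabsM cabsX exprS ler_piMl ?mulr_ge0 ?exprn_ge0 ?cabs_ge0.
have q01 : 0 <= cabs t < 1 by rewrite cabs_ge0.
apply: le_trans (has_sum_le q01 tb h) _.
rewrite mulrC ler_wpM2r ?cabs_ge0// -[leRHS]invrK lef_pV2 ?posrE; lra.
Qed.

(** Near a point off the cut the branch is [clog alpha y + log1p (h / y)]: the
    right exponential, and an argument that stays in the window. *)
Lemma clog_local alpha y : ~ slit_ray alpha y ->
  exists2 r : R, 0 < r <= cabs y / 2 & forall h, cabs h < r ->
    clog alpha (y + h) = clog alpha y + log1p (h / y) /\ ~ slit_ray alpha (y + h).
Proof.
move=> ny; have [y0 ey /andP[i1 i2]] := clog_off_slit ny.
have yp : 0 < cabs y by rewrite cabs_gt0.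
set w := clog alpha y in ey i1 i2 *.
pose e := Num.min (complex.Im w - (alpha - pi)) (alpha + pi - complex.Im w).
have e0 : 0 < e by rewrite lt_min !subr_gt0 i1.
(* [2^-1] keeps [h / y] where [log1p] is at most twice its argument; then
   [e / 2] keeps its imaginary part below the distance [e] to the window's ends. *)
exists (cabs y * Num.min 2^-1 (e / 2)).
  rewrite mulr_gt0 ?lt_min ?divr_gt0 ?invr_gt0 ?ltr0n//=.
  by rewrite ler_wpM2l ?cabs_ge0// ge_min lexx.
move=> h; rewrite -ltr_pdivrMl// mulrC lt_min.
have -> : cabs h / cabs y = cabs (h / y) by rewrite cabsM cabsV.
set t := h / y => /andP[t1 t2].
have yhE : y + h = cexp (w + log1p t).
  rewrite cexpD ey cexp_log1p; last by lra.
  by rewrite /t mulrDr mulr1 mulrCA mulfV// mulr1.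
have : `|complex.Im (log1p t)| < e.
  apply: le_lt_trans (Im_le_cabs _) _.
  by apply: le_lt_trans (cabs_log1p_le (ltW t1)) _; lra.
rewrite lt_min !ltr_norml => /andP[/andP[l1 l2] /andP[l3 l4]].
rewrite yhE; have i3 : alpha - pi < complex.Im (w + log1p t) < alpha + pi.
  by rewrite ImD; apply/andP; split; lra.
have /andP[i4 i5] := i3.
split; first by rewrite clog_unique// i4 ltW.
move/slit_rayP; rewrite i4 (ltW i5) => /(_ isT) e1; lra.
Qed.

Lemma clog_analytic1 alpha y : ~ slit_ray alpha y ->
  analytic1 (clog alpha) y y^-1.
Proof.
move=> ny; have [y0 _ _] := clog_off_slit ny.
have yp : 0 < cabs y by rewrite cabs_gt0.
have [r /andP[r0 ry] hr] := clog_local ny.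
pose b k := if k is 0%N then clog alpha y else log1p_coef k / y ^+ k.
exists b, r, (cabs (clog alpha y) + 1); split=> //.
- by rewrite /b /= expr0 divr1 mul1r expr1.
- case=> [|k]; first by rewrite /b mulr1 lerDl.
  rewrite /b cabsM cabsV cabsX -mulrA -[leLHS]addr0 addrC lerD ?cabs_ge0//.
  rewrite mulr_ile1 ?cabs_ge0 ?log1p_coef_le1//.
    by rewrite mulr_ge0 ?invr_ge0 ?exprn_ge0 ?cabs_ge0// ltW.
  rewrite mulrC ler_pdivrMr ?exprn_gt0// mul1r lerXn2r ?nnegrE ?cabs_ge0 ?(ltW r0)//.
  by apply: le_trans ry _; lra.
move=> h hlt; have [-> _] := hr h hlt.
have t1 : cabs (h / y) < 1.
  by rewrite cabsM cabsV ltr_pdivrMr// mul1r; lra.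
have := has_sum_behead (log1p_has_sum t1); rewrite /= mul0r subr0 => hs.
have -> : clog alpha y + log1p (h / y) = b 0%N * h ^+ 0 + log1p (h / y).
  by rewrite /b mulr1.
apply: has_sum_cons; apply: has_sum_eq hs => k.
rewrite /b expr_div_n -[RHS]mulrA; congr (_ * _); exact: mulrC.
Qed.

Lemma open_slit_domain alpha : open (slit_domain (R := R) alpha).
Proof.
rewrite openE => -[x y] /= ny; have [r /andP[r0 _] hr] := clog_local ny.
apply/nbhs_ballP; exists r%:C; rewrite /= ?ltcR// => -[x' y'] [_ /= yy'].
rewrite /slit_domain/= -(subrK y y') addrC.
apply: (hr _ _).2; move: yy'; rewrite /ball/= norm_ltC.
done.
Qed.

End Logarithm.

(** * Products of double series *)

Section TriangularSums.
Variable V : comNzRingType.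
Implicit Types (g a b : nat -> nat -> V) (n : nat).

(** Summation over [p + l <= n], by diagonals and by rows. *)
Lemma sum_triangle g n :
  \sum_(m < n.+1) \sum_(p < m.+1) g p (m - p)%N =
  \sum_(p < n.+1) \sum_(l < (n - p).+1) g p l.
Proof.
elim: n => [|n IH]; first by rewrite !big_ord1.
rewrite big_ord_recr/= IH [RHS]big_ord_recr/= subnn big_ord1 [X in _ + X]big_ord_recr/=.
rewrite subnn addrA -big_split/=; congr (_ + _); apply: eq_bigr => p _.
by rewrite (subSn (ltn_ord p : (p <= n)%N)) [RHS]big_ord_recr.
Qed.

Lemma sum_triangle_swap g n :
  \sum_(p < n.+1) \sum_(l < (n - p).+1) g p l =
  \sum_(l < n.+1) \sum_(p < (n - l).+1) g p l.
Proof.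
rewrite -sum_triangle -(sum_triangle (fun l p => g p l)).
apply: eq_bigr => m _; rewrite (reindex_inj rev_ord_inj)/=.
by apply: eq_bigr => p _; rewrite subSS subKn// -ltnS.
Qed.

Definition diag a n := \sum_(i < n.+1) a i (n - i)%N.

Definition convol a b i j :=
  \sum_(p < i.+1) \sum_(l < j.+1) a p l * b (i - p)%N (j - l)%N.

(** Both sides run over the quadruples of indices with sum [n]. *)
Lemma diag_convol a b n :
  diag (convol a b) n = \sum_(m < n.+1) diag a m * diag b (n - m)%N.
Proof.
transitivity (\sum_(i < n.+1) \sum_(p < i.+1)
    \sum_(l < (n - (p + (i - p))).+1)
       a p l * b (i - p)%N (n - (p + (i - p)) - l)%N).
  apply: eq_bigr => i _; apply: eq_bigr => p _.
  by rewrite subnKC// -ltnS.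
rewrite (sum_triangle (fun p q => \sum_(l < (n - (p + q)).+1)
  a p l * b q (n - (p + q) - l)%N)).
transitivity (\sum_(m < n.+1) \sum_(p < m.+1)
   a p (m - p)%N * diag b (n - (p + (m - p)))%N); last first.
  apply: eq_bigr => m _; rewrite mulr_suml; apply: eq_bigr => p _.
  by rewrite subnKC// -ltnS.
rewrite (sum_triangle (fun p l => a p l * diag b (n - (p + l)))).
apply: eq_bigr => p _.
transitivity (\sum_(q < (n - p).+1) \sum_(l < (n - p - q).+1)
    a p l * b q (n - p - l - q)%N).
  apply: eq_bigr => q _; rewrite subnDA.
  by apply: eq_bigr => l _; congr (_ * b _ _); exact: subnAC.
rewrite (sum_triangle_swap (fun q l => a p l * b q (n - p - l - q)%N)).
by apply: eq_bigr => l _; rewrite mulr_sumr subnDA.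
Qed.

End TriangularSums.

Section CauchyProduct.
Variable R : realType.
Local Notation C := (CC R).

Lemma natr_le_exp2 n : n.+1%:R <= 2 ^+ n :> R.
Proof. by rewrite -natrX ler_nat ltn_expl. Qed.

(** The error after [N] terms consists of [N] products of a term and a tail; the
    ratio is taken below [1 / 2] because [N * q ^ N <= (2 * q) ^ N]. *)
Lemma has_sum_cauchy (s t : nat -> C) (x y : C) (K L q : R) : 0 <= q < 2^-1 ->
  (forall n, cabs (s n) <= K * q ^+ n) -> (forall n, cabs (t n) <= L * q ^+ n) ->
  has_sum s x -> has_sum t y ->
  has_sum (fun n => \sum_(m < n.+1) s m * t (n - m)%N) (x * y).
Proof.
move=> /andP[q0 q2] sK tL sx ty.
have q01 : 0 <= q < 1 by rewrite q0/=; lra.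
have sE N : series (fun n => \sum_(m < n.+1) s m * t (n - m)%N) N =
    \sum_(m < N) s m * series t (N - m)%N.
  elim: N => [|N IH]; first by rewrite /series/= big_nil big_ord0.
  rewrite [LHS]/series/= big_nat_recr//= -/(series _ N).
  move: IH; rewrite {1}/series/= => ->.
  rewrite [X in _ + X]big_ord_recr/= [RHS]big_ord_recr/= addrA -big_split/=.
  rewrite subnn subSnn {3}/series/= big_nat1; congr (_ + _).
  apply: eq_bigr => m _; rewrite -mulrDr subSn; last exact: ltnW.
  by rewrite /series/= big_nat_recr.
have K0 : 0 <= K by apply: le_trans (cabs_ge0 (s 0%N)) _; have := sK 0%N; rewrite mulr1.
have L0 : 0 <= L by apply: le_trans (cabs_ge0 (t 0%N)) _; have := tL 0%N; rewrite mulr1.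
pose B := K * L / (1 - q).
have B0 : 0 <= B by rewrite !mulr_ge0// invr_ge0; lra.
have key N : cabs (series (fun n => \sum_(m < n.+1) s m * t (n - m)%N) N
    - series s N * y) <= B * (2 * q) ^+ N.
  rewrite sE /series/= big_mkord mulr_suml -sumrB.
  apply: le_trans (cabs_sum _ _ _) _.
  apply: (@le_trans _ _ (\sum_(m < N) B * q ^+ N)).
    apply: ler_sum => m _; rewrite -mulrBr cabsM cabs_distC.
    have tt := has_sum_tail (N - m)%N q01 tL ty.
    have := ler_pM (cabs_ge0 _) (cabs_ge0 _) (sK m) tt; move/le_trans; apply.
    have -> : q ^+ N = q ^+ m * q ^+ (N - m) by rewrite -exprD subnKC// ltnW.
    by rewrite /B le_eqVlt; apply/orP; left; apply/eqP; ring.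
  rewrite sumr_const card_ord -[leLHS]mulr_natl mulrCA ler_wpM2l// exprMn.
  rewrite ler_wpM2r ?exprn_ge0//; case: N => [|N]; first by rewrite expr0.
  by apply: le_trans (natr_le_exp2 N.+1); rewrite ler_nat.
have h : (fun N => series s N * y) @ \oo --> x * y.
  by case: sx => sx; exact: cvgM sx (cvg_cst y).
split; move/cvg_cabs : h => h.
apply: (@cvg_cabs_le _ _ _ _ _ _ (fun N => B * (2 * q) ^+ N
  + cabs (series s N * y - x * y))).
  apply: nearW => N; apply: le_trans (lerD (key N) (lexx _)).
  by rewrite -[X in cabs X <= _](subrKA (series s N * y)) cabsD.
rewrite -[0 in X in _ --> X]addr0; apply: cvgD => //.
rewrite -(mulr0 B); apply: cvgM; first exact: cvg_cst.
by apply: cvg_expr; rewrite ger0_norm; lra.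
Qed.

End CauchyProduct.

(** * Analytic functions of two variables *)

Section AnalyticTwo.
Variable R : realType.
Local Notation C := (CC R).
Local Notation C2 := (CC R * CC R)%type.
Implicit Types (f g : C2 -> C) (p : C2) (a b : nat -> nat -> C) (h k : C) (r M : R).

Definition monom a h k i j : C := a i j * h ^+ i * k ^+ j.

Definition expansion2 f p a r M := [/\ 0 < r,
  forall i j, cabs (a i j) * r ^+ (i + j) <= M &
  forall h k, cabs h < r -> cabs k < r ->
    has_sum (diag (monom a h k)) (f (p.1 + h, p.2 + k))].

(** The first-order coefficients [dx] and [dy] are carried along, so that the
    closure properties also compute the differential. *)
Definition analytic2 f p (dx dy : C) := exists (a : nat -> nat -> C) (r M : R),
  [/\ expansion2 f p a r M, a 1%N 0%N = dx & a 0%N 1%N = dy].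

Lemma analytic2_at f p dx dy : analytic2 f p dx dy -> analytic_at f p.
Proof.
move=> [a [r [M [[r0 aM fs] _ _]]]]; exists a, r%:C, M%:C; split.
- by rewrite ltcR.
- by move=> i j; rewrite normE -rmorphXn -rmorphM lecR; exact: aM.
- by move=> h k; rewrite !normE !ltcR => hr kr; case: (fs h k hr kr).
Qed.

Lemma expansion2_shrink f p a r s M : 0 < s <= r ->
  expansion2 f p a r M -> expansion2 f p a s M.
Proof.
move=> /andP[s0 sr] [r0 aM fs]; split=> // [i j|h k hs ks].
  apply: le_trans (aM i j); rewrite ler_wpM2l ?cabs_ge0//.
  by rewrite lerXn2r ?nnegrE// ltW.
by apply: fs; [exact: lt_le_trans sr|exact: lt_le_trans sr].
Qed.

Lemma diag_monom0 a n : diag (monom a 0 0) n = if n is 0%N then a 0%N 0%N else 0.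
Proof.
rewrite /diag /monom; case: n => [|n]; first by rewrite big_ord1 !mulr1.
apply: big1 => i _; have [i0|i0] := posnP i.
  by rewrite i0 subn0 [0 ^+ n.+1]expr0n mulr0.
by rewrite [0 ^+ i]expr0n (gtn_eqF i0) mulr0 mul0r.
Qed.

Lemma expansion2_value f p a r M : expansion2 f p a r M -> f p = a 0%N 0%N.
Proof.
move=> [r0 _ fs]; have := fs 0 0; rewrite cabs0 !addr0 => /(_ r0 r0).
rewrite -surjective_pairing => h1.
have z n : (1 <= n)%N -> diag (monom a 0 0) n = 0.
  by rewrite diag_monom0; case: n.
rewrite (has_sum_unique h1 (has_sum_finite z)).
by rewrite /series/= big_nat1 diag_monom0.
Qed.

Lemma diag_monom_le a h k r M m n : 0 < r ->
  (forall i j, cabs (a i j) * r ^+ (i + j) <= M) -> cabs h <= m -> cabs k <= m ->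
  cabs (diag (monom a h k) n) <= M * (2 * (m / r)) ^+ n.
Proof.
move=> r0 aM hm km; rewrite /diag /monom.
have m0 : 0 <= m by exact: le_trans (cabs_ge0 h) hm.
have M0 : 0 <= M by apply: le_trans (aM 0%N 0%N); rewrite mulr1 cabs_ge0.
apply: le_trans (cabs_sum _ _ _) _.
apply: (@le_trans _ _ (\sum_(i < n.+1) M * (m / r) ^+ n)).
  apply: ler_sum => i _; have i_n : (i <= n)%N by rewrite -ltnS.
  have := aM i (n - i)%N; rewrite subnKC// -ler_pdivlMr ?exprn_gt0// => ha.
  rewrite !cabsM !cabsX -mulrA.
  have mn : cabs h ^+ i * cabs k ^+ (n - i) <= m ^+ n.
    rewrite -[in leRHS](subnKC i_n) exprD ler_pM ?exprn_ge0 ?cabs_ge0//.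
      by rewrite lerXn2r ?nnegrE ?cabs_ge0.
    by rewrite lerXn2r ?nnegrE ?cabs_ge0.
  have -> : M * (m / r) ^+ n = M / r ^+ n * m ^+ n by rewrite expr_div_n; ring.
  by rewrite ler_pM ?cabs_ge0// mulr_ge0 ?exprn_ge0 ?cabs_ge0.
rewrite sumr_const card_ord -[leLHS]mulr_natl mulrCA ler_wpM2l// [leRHS]exprMn.
by rewrite ler_wpM2r ?natr_le_exp2// exprn_ge0// divr_ge0// ltW.
Qed.

Lemma analytic2_near f g p dx dy r : 0 < r ->
  (forall h k, cabs h < r -> cabs k < r ->
    f (p.1 + h, p.2 + k) = g (p.1 + h, p.2 + k)) ->
  analytic2 f p dx dy -> analytic2 g p dx dy.
Proof.
move=> r0 fg [a [s [M [es a1 a2]]]]; exists a, (Num.min r s), M; split=> //.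
have s0 : 0 < s by case: es.
have rs : 0 < Num.min r s <= s by rewrite lt_min r0 s0 ge_min lexx orbT.
have [m0 aM fs] := expansion2_shrink rs es; split=> // h k hm km.
rewrite -fg; first exact: fs.
  by apply: lt_le_trans hm _; rewrite ge_min lexx.
by apply: lt_le_trans km _; rewrite ge_min lexx.
Qed.

Lemma analytic2_ext f g p dx dy : f =1 g -> analytic2 f p dx dy -> analytic2 g p dx dy.
Proof. by move=> /funext ->. Qed.

Lemma analytic2_cst (c : C) p : analytic2 (fun=> c) p 0 0.
Proof.
exists (fun i j => if (i + j)%N is 0%N then c else 0), 1, (cabs c); split=> //.
split=> // [i j|h k _ _].
  by rewrite expr1n mulr1; case: (i + j)%N => [|n]; rewrite ?cabs0 ?cabs_ge0.
have z n : (1 <= n)%N -> diag (monom (fun i j => if (i + j)%N is 0%N then c else 0) h k) n = 0.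
  case: n => // n _; apply: big1 => i _; rewrite /monom subnKC; last by rewrite -ltnS.
  by rewrite !mul0r.
have := has_sum_finite z; rewrite [in X in has_sum _ X]/series/= big_nat1.
by rewrite {2}/diag big_ord1 /monom /= !mulr1.
Qed.

Lemma analytic2_fst p : analytic2 fst p 1 0.
Proof.
pose a i j : C := match i, j with 0%N, 0%N => p.1 | 1%N, 0%N => 1 | _, _ => 0 end.
exists a, 1, (cabs p.1 + 1); split=> //; split=> // [i j|h k _ _].
  rewrite expr1n mulr1; have := cabs_ge0 p.1.
  by case: i j => [|[|i]] [|j]; rewrite /a /= ?cabs0 ?cabs1; lra.
have z n : (2 <= n)%N -> diag (monom a h k) n = 0.
  case: n => [|[|n]] // _; apply: big1 => i _; rewrite /monom.
  by case: i => -[|[|i]] //= lt_i; rewrite !mul0r.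
have := has_sum_finite z; rewrite [in X in has_sum _ X]/series/= big_nat_recr//= big_nat1.
rewrite [in X in has_sum _ X]/diag big_ord1 !big_ord_recl big_ord0 /monom /= !mulr1 !mul1r mul0r addr0 add0r.
by rewrite expr1.
Qed.

Lemma analytic2_snd (f : C -> C) p d :
  analytic1 f p.2 d -> analytic2 (fun q => f q.2) p 0 d.
Proof.
move=> [b [r [M [r0 b1 bM fs]]]].
pose a i j : C := if i is 0%N then b j else 0.
have M0 : 0 <= M := coef_bound_ge0 bM.
exists a, r, M; split=> //; split=> // [[|i] j|h k hr kr].
- exact: bM.
- by rewrite /a cabs0 mul0r.
apply: has_sum_eq (fs k kr) => n.
rewrite /diag big_ord_recl big1 ?addr0; first by rewrite /monom /a /= subn0 mulr1.
by move=> i _; rewrite /monom /= !mul0r.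
Qed.

Lemma analytic2D f g p fx fy gx gy : analytic2 f p fx fy -> analytic2 g p gx gy ->
  analytic2 (fun q => f q + g q) p (fx + gx) (fy + gy).
Proof.
move=> [a [r [M [ea a1 a2]]]] [b [s [N [eb b1 b2]]]].
have r0 : 0 < r by case: ea.
have s0 : 0 < s by case: eb.
have rs : 0 < Num.min r s <= r by rewrite lt_min r0 s0 ge_min lexx.
have sr : 0 < Num.min r s <= s by rewrite lt_min r0 s0 ge_min lexx orbT.
have [m0 aM fs] := expansion2_shrink rs ea.
have [_ bN gs] := expansion2_shrink sr eb.
exists (fun i j => a i j + b i j), (Num.min r s), (M + N).
split; [|by rewrite a1 b1|by rewrite a2 b2]; split=> // [i j|h k hm km].
  apply: le_trans (lerD (aM i j) (bN i j)); rewrite -mulrDl ler_wpM2r ?cabsD//.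
  by rewrite exprn_ge0 // ltW.
apply: has_sum_eq (has_sumD (fs h k hm km) (gs h k hm km)) => n.
by rewrite /diag -big_split; apply: eq_bigr => i _; rewrite /monom !mulrDl.
Qed.

Lemma convol_monom a b h k i j :
  convol (monom a h k) (monom b h k) i j = monom (convol a b) h k i j.
Proof.
rewrite /convol /monom !mulr_suml; apply: eq_bigr => p _.
rewrite !mulr_suml; apply: eq_bigr => l _.
have -> : h ^+ i = h ^+ p * h ^+ (i - p) by rewrite -exprD subnKC// -ltnS.
have -> : k ^+ j = k ^+ l * k ^+ (j - l) by rewrite -exprD subnKC// -ltnS.
ring.
Qed.

(** Products of homogeneous components are a Cauchy product of ordinary series,
    so a double series is multiplied by the one-variable rule. *)
Lemma has_sum_convol a b h k r M N x y : 0 < r ->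
  (forall i j, cabs (a i j) * r ^+ (i + j) <= M) ->
  (forall i j, cabs (b i j) * r ^+ (i + j) <= N) ->
  cabs h < r / 4 -> cabs k < r / 4 ->
  has_sum (diag (monom a h k)) x -> has_sum (diag (monom b h k)) y ->
  has_sum (diag (monom (convol a b) h k)) (x * y).
Proof.
move=> r0 aM bN hr kr sx sy.
pose m := Num.max (cabs h) (cabs k).
have hm : cabs h <= m by rewrite le_max lexx.
have km : cabs k <= m by rewrite le_max lexx orbT.
have m0 : 0 <= m := le_trans (cabs_ge0 h) hm.
have mr : m / r < 4^-1.
  by rewrite ltr_pdivrMr// mulrC gt_max hr kr.
have q01 : 0 <= 2 * (m / r) < 2^-1.
  have mr0 : 0 <= m / r by rewrite divr_ge0 // ltW.
  by apply/andP; split; lra.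
have := has_sum_cauchy q01 (fun n => diag_monom_le n r0 aM hm km)
  (fun n => diag_monom_le n r0 bN hm km) sx sy.
apply: has_sum_eq => n; rewrite -diag_convol; apply: eq_bigr => i _.
exact: convol_monom.
Qed.

(** Halving the radius absorbs the number [(i + 1) * (j + 1)] of terms, which is
    at most [2 ^ (i + j)]. *)
Lemma convol_bound a b r M N : 0 < r ->
  (forall i j, cabs (a i j) * r ^+ (i + j) <= M) ->
  (forall i j, cabs (b i j) * r ^+ (i + j) <= N) ->
  forall i j, cabs (convol a b i j) * (r / 2) ^+ (i + j) <= M * N.
Proof.
move=> r0 aM bN i j.
have M0 : 0 <= M by apply: le_trans (aM 0%N 0%N); rewrite mulr1 cabs_ge0.
have N0 : 0 <= N by apply: le_trans (bN 0%N 0%N); rewrite mulr1 cabs_ge0.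
rewrite exprMn exprVn mulrA ler_pdivrMr ?exprn_gt0//.
rewrite -(ger0_norm (exprn_ge0 (i + j) (ltW r0))) -cabsR -cabsM /convol mulr_suml.
apply: le_trans (cabs_sum _ _ _) _.
apply: (@le_trans _ _ (\sum_(p < i.+1) \sum_(l < j.+1) M * N)).
  apply: ler_sum => p _; rewrite mulr_suml; apply: le_trans (cabs_sum _ _ _) _.
  apply: ler_sum => l _; rewrite !cabsM cabsR ger0_norm ?exprn_ge0 ?(ltW r0)//.
  have -> : (i + j = (p + l) + ((i - p) + (j - l)))%N.
    by have := ltn_ord p; have := ltn_ord l; lia.
  rewrite exprD mulrACA ler_pM// ?mulr_ge0 ?cabs_ge0 ?exprn_ge0 ?(ltW r0)//.
rewrite !sumr_const !card_ord -mulrnA -[leLHS]mulr_natr ler_wpM2l ?mulr_ge0//.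
by rewrite natrM exprD mulrC ler_pM ?natr_le_exp2.
Qed.

Lemma analytic2M f g p fx fy gx gy : analytic2 f p fx fy -> analytic2 g p gx gy ->
  analytic2 (fun q => f q * g q) p (f p * gx + fx * g p) (f p * gy + fy * g p).
Proof.
move=> [a [r [M [ea a1 a2]]]] [b [s [N [eb b1 b2]]]].
rewrite (expansion2_value ea) (expansion2_value eb).
have r0 : 0 < r by case: ea.
have s0 : 0 < s by case: eb.
have rs : 0 < Num.min r s <= r by rewrite lt_min r0 s0 ge_min lexx.
have sr : 0 < Num.min r s <= s by rewrite lt_min r0 s0 ge_min lexx orbT.
have [m0 aM fs] := expansion2_shrink rs ea.
have [_ bN gs] := expansion2_shrink sr eb.
set m := Num.min r s in m0 aM fs bN gs.
exists (convol a b), (m / 4), (M * N); split.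
- split; first by rewrite divr_gt0.
    move=> i j; apply: le_trans (convol_bound m0 aM bN i j).
    by rewrite ler_wpM2l ?cabs_ge0// lerXn2r ?nnegrE ?divr_ge0 ?(ltW m0)//; lra.
  move=> h k hm km; apply: (has_sum_convol m0 aM bN hm km).
    by apply: fs; lra.
  by apply: gs; lra.
- by rewrite /convol !big_ord_recl !big_ord0 /= -a1 -b1 !addr0.
- by rewrite /convol !big_ord_recl !big_ord0 /= -a2 -b2 !addr0.
Qed.

Lemma analytic2Z (c : C) f p fx fy : analytic2 f p fx fy ->
  analytic2 (fun q => c * f q) p (c * fx) (c * fy).
Proof.
by move=> hf; have := analytic2M (analytic2_cst c p) hf; rewrite !mul0r !addr0.
Qed.


(** The coefficients of the inverse series, by recursion on the total degree
    [i + j], which the argument [n] bounds from above. *)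
Fixpoint inv_coef_fuel a n i j : C := if n is n'.+1 then
  ((i + j == 0)%N%:R - \sum_(p < i.+1) \sum_(l < j.+1 | (0 < p + l)%N)
     a p l * inv_coef_fuel a n' (i - p)%N (j - l)%N) / a 0%N 0%N
  else 0.

Definition inv_coef a i j := inv_coef_fuel a (i + j).+1 i j.

Lemma inv_coef_fuelE a n i j : (i + j < n)%N ->
  inv_coef_fuel a n i j = inv_coef a i j.
Proof.
rewrite /inv_coef; elim: n {-2}n (leqnn n) i j => [|N IH] [|n] nN i j ijn //=.
congr (_ / _); congr (_ - _).
apply: eq_bigr => p _; apply: eq_bigr => l pl; congr (_ * _).
have := ltn_ord p; have := ltn_ord l => lj pi.
by rewrite IH ?[RHS]IH //; lia.
Qed.

Lemma inv_coefE a i j : inv_coef a i j =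
  ((i + j == 0)%N%:R - \sum_(p < i.+1) \sum_(l < j.+1 | (0 < p + l)%N)
     a p l * inv_coef a (i - p)%N (j - l)%N) / a 0%N 0%N.
Proof.
rewrite {1}/inv_coef /=; congr (_ / _); congr (_ - _).
apply: eq_bigr => p _; apply: eq_bigr => l pl; congr (_ * _).
have := ltn_ord p; have := ltn_ord l => lj pi.
by apply: inv_coef_fuelE; lia.
Qed.

Lemma convol_inv_coef a i j : a 0%N 0%N != 0 ->
  convol a (inv_coef a) i j = (i + j == 0)%N%:R.
Proof.
move=> a0; rewrite /convol big_ord_recl [X in X + _]big_ord_recl /= !subn0.
rewrite [X in a 0%N 0%N * X]inv_coefE mulrC divfK//.
rewrite big_ord_recl [X in _ - (X + _)]big_mkcond [X in _ - (X + _)]big_ord_recl/= add0r.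
rewrite -!addrA -[RHS]addr0; congr (_ + _).
rewrite opprD !subn0; set S := \sum_(i0 < j) _; set T := \sum_(i0 < i) _.
ring.
Qed.

(** Since [p + l] is positive, [(u ^ 2) ^ (p + l) <= u * u ^ (p + l)], so the sum
    without its leading term is as small as [u]. *)
Lemma sum_geometric2_le (u : R) i j : 0 <= u <= 2^-1 ->
  \sum_(p < i.+1) \sum_(l < j.+1 | (0 < p + l)%N) (u ^+ 2) ^+ (p + l) <= 4 * u.
Proof.
move=> /andP[u0 u2].
have geo n : \sum_(p < n) u ^+ p <= 2.
  have [->|n0] := posnP n; first by rewrite big_ord0.
  have e : (1 - u) * \sum_(p < n) u ^+ p = 1 - u ^+ n.
    by rewrite -opprB mulNr -subrX1 opprB.
  have s0 : 0 <= \sum_(p < n) u ^+ p by rewrite sumr_ge0// => p _; exact: exprn_ge0.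
  have un : 0 <= u ^+ n by exact: exprn_ge0.
  nra.
apply: (@le_trans _ _ (u * ((\sum_(p < i.+1) u ^+ p) * (\sum_(l < j.+1) u ^+ l)))).
  rewrite mulr_suml mulr_sumr; apply: ler_sum => p _.
  rewrite !mulr_sumr [leLHS]big_mkcond; apply: ler_sum => l _.
  case: ifP => [pl|_]; last by rewrite !mulr_ge0 ?exprn_ge0.
  rewrite -exprD -exprS -exprM ler_wiXn2l ?u0//; first by lra.
  by lia.
have : (\sum_(p < i.+1) u ^+ p) * (\sum_(l < j.+1) u ^+ l) <= 2 * 2.
  by rewrite ler_pM// sumr_ge0// => p _; rewrite exprn_ge0.
nra.
Qed.

(** After the radius is multiplied by [u ^ 2], the coefficients other than the
    constant one weigh together at most half of the constant one, and the
    recursion reproduces its own bound. *)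
Lemma inv_coef_bound a r M (u : R) : 0 < r -> 0 <= u <= 2^-1 ->
  (forall i j, cabs (a i j) * r ^+ (i + j) <= M) -> a 0%N 0%N != 0 ->
  8 * M * u <= cabs (a 0%N 0%N) ->
  forall i j, cabs (inv_coef a i j) * (u ^+ 2 * r) ^+ (i + j) <= 2 / cabs (a 0%N 0%N).
Proof.
move=> r0 u01 aM a0 uM i j; have /andP[u0 u2] := u01.
set A := cabs (a 0%N 0%N) in uM *; have A0 : 0 < A by rewrite cabs_gt0.
have M0 : 0 <= M by apply: le_trans (aM 0%N 0%N); rewrite mulr1 cabs_ge0.
pose s := u ^+ 2 * r; have s0 : 0 <= s by rewrite mulr_ge0 ?exprn_ge0// ltW.
rewrite -/s; elim: (i + j)%N {-2}i {-2}j (leqnn (i + j)) => {i j} [|n IH] i j ijn.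
  have [-> ->] : i = 0%N /\ j = 0%N by lia.
  rewrite inv_coefE /= big_ord_recl big_ord0 big_mkcond big_ord_recl big_ord0 /=.
  rewrite !addr0 subr0 mulr1 mul1r cabsV -/A -[leLHS]mul1r ler_wpM2r ?invr_ge0 ?(ltW A0)//.
  by rewrite ler1n.
have [h|h] := leqP (i + j) n; first exact: IH.
have ij0 : (i + j == 0)%N = false by apply/negbTE; rewrite -lt0n; lia.
rewrite inv_coefE ij0 sub0r mulNr cabsN cabsM cabsV -/A mulrAC ler_wpM2r ?invr_ge0 ?(ltW A0)//.
rewrite -(ger0_norm (exprn_ge0 (i + j) s0)) -cabsR -cabsM mulr_suml.
apply: le_trans (cabs_sum _ _ _) _.
apply: (@le_trans _ _ (\sum_(p < i.+1) \sum_(l < j.+1 | (0 < p + l)%N)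
   M * (2 / A) * (u ^+ 2) ^+ (p + l))).
  apply: ler_sum => p _; rewrite mulr_suml; apply: le_trans (cabs_sum _ _ _) _.
  apply: ler_sum => l pl; rewrite 2!cabsM cabsR ger0_norm ?exprn_ge0//.
  have pi := ltn_ord p; have lj := ltn_ord l.
  have -> : (i + j = (p + l) + ((i - p) + (j - l)))%N by lia.
  have IH' : cabs (inv_coef a (i - p) (j - l)) * s ^+ (i - p + (j - l)) <= 2 / A.
    by apply: IH; lia.
  have haM : cabs (a p l) * s ^+ (p + l) <= M * (u ^+ 2) ^+ (p + l).
    by rewrite /s exprMn mulrCA [leRHS]mulrC ler_wpM2l ?exprn_ge0.
  rewrite exprD mulrACA.
  have -> : M * (2 / A) * (u ^+ 2) ^+ (p + l) = M * (u ^+ 2) ^+ (p + l) * (2 / A) by ring.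
  by apply: ler_pM haM IH'; rewrite mulr_ge0 ?exprn_ge0 ?cabs_ge0.
under eq_bigr do rewrite -mulr_sumr; rewrite -mulr_sumr.
apply: (@le_trans _ _ (M * (2 / A) * (4 * u))).
  by rewrite ler_wpM2l ?sum_geometric2_le// !mulr_ge0// invr_ge0 ltW.
have -> : M * (2 / A) * (4 * u) = (8 * M * u) / A by ring.
by rewrite ler_pdivrMr//; lra.
Qed.

(** The product with the original series has all coefficients zero but the first,
    so the inverse series sums to the inverse wherever both converge. *)
Lemma analytic2V f p fx fy : analytic2 f p fx fy -> f p != 0 ->
  analytic2 (fun q => (f q)^-1) p (- fx / f p ^+ 2) (- fy / f p ^+ 2).
Proof.
move=> [a [r [M [ea a1 a2]]]] fp0.
have f0 := expansion2_value ea; have a0 : a 0%N 0%N != 0 by rewrite -f0.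
have [r0 aM fs] := ea.
set A := cabs (a 0%N 0%N); have A0 : 0 < A by rewrite cabs_gt0.
have M0 : 0 <= M by apply: le_trans (aM 0%N 0%N); rewrite mulr1 cabs_ge0.
pose u := Num.min 2^-1 (A / (8 * (M + 1))).
have d0 : 0 < 8 * (M + 1) by rewrite mulr_gt0// ltr_wpDl.
have u0 : 0 < u by rewrite lt_min invr_gt0 ltr0n divr_gt0.
have u2 : u <= 2^-1 by rewrite ge_min lexx.
have uA : 8 * M * u <= A.
  have : u <= A / (8 * (M + 1)) by rewrite ge_min lexx orbT.
  rewrite ler_pdivlMr// => h; apply: le_trans h; rewrite mulrC ler_wpM2l ?(ltW u0)//.
  by lra.
pose s := u ^+ 2 * r; have s0 : 0 < s by rewrite mulr_gt0 ?exprn_gt0.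
have sr : s <= r by rewrite ler_piMl ?(ltW r0)// exprn_ile1 ?(ltW u0)//; lra.
have u01 : 0 <= u <= 2^-1 by rewrite ltW.
have bM := inv_coef_bound r0 u01 aM a0 uA; rewrite -/s in bM.
have sr' : 0 < s <= r by rewrite s0.
have [_ aM' fs'] := expansion2_shrink sr' ea.
exists (inv_coef a), (s / 4), (2 / A); split.
- split; first by rewrite divr_gt0.
    move=> i j; apply: le_trans (bM i j); rewrite ler_wpM2l ?cabs_ge0//.
    by rewrite lerXn2r ?nnegrE ?divr_ge0 ?(ltW s0)//; lra.
  move=> h k hm km.
  have m4 : Num.max (cabs h) (cabs k) / s < 4^-1.
    by rewrite ltr_pdivrMr// mulrC gt_max hm km.
  have hm' : cabs h <= Num.max (cabs h) (cabs k) by rewrite le_max lexx.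
  have km' : cabs k <= Num.max (cabs h) (cabs k) by rewrite le_max lexx orbT.
  have q01 : 0 <= 2 * (Num.max (cabs h) (cabs k) / s) < 1.
    have mr0 : 0 <= Num.max (cabs h) (cabs k) / s.
      by rewrite divr_ge0 ?(ltW s0)// (le_trans (cabs_ge0 h)).
    by apply/andP; split; lra.
  have [l hl _] := geometric_has_sum q01 (fun n => diag_monom_le n s0 bM hm' km').
  have fhk : has_sum (diag (monom a h k)) (f (p.1 + h, p.2 + k)).
    by apply: fs'; lra.
  have := has_sum_convol s0 aM' bM hm km fhk hl.
  have z n : (1 <= n)%N -> diag (monom (convol a (inv_coef a)) h k) n = 0.
    case: n => // n _; apply: big1 => i _.
    by rewrite /monom convol_inv_coef// subnKC ?mul0r// -ltnS.
  move=> /has_sum_unique /(_ (has_sum_finite z)).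
  rewrite /series/= big_nat1 /diag big_ord1 /monom convol_inv_coef//= !mulr1 => e.
  have fn0 : f (p.1 + h, p.2 + k) != 0.
    by apply: contra_eq_neq e => ->; rewrite mul0r eq_sym oner_eq0.
  by have -> : (f (p.1 + h, p.2 + k))^-1 = l by apply: (mulfI fn0); rewrite e mulfV.
- have := convol_inv_coef 1 0 a0; have := convol_inv_coef 0 0 a0.
  rewrite /convol !big_ord_recl !big_ord0 /= !addr0 f0 -a1.
  move: (inv_coef a 0 0) (inv_coef a 1 0) => b00 b10 e1 e2.
  apply: (mulfI a0); move: e2 => /eqP; rewrite addr_eq0 => /eqP ->.
  have -> : b00 = (a 0%N 0%N)^-1 by apply: (mulfI a0); rewrite e1 mulfV.
  by field.
- have := convol_inv_coef 0 1 a0; have := convol_inv_coef 0 0 a0.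
  rewrite /convol !big_ord_recl !big_ord0 /= !addr0 f0 -a2.
  move: (inv_coef a 0 0) (inv_coef a 0 1) => b00 b01 e1 e2.
  apply: (mulfI a0); move: e2 => /eqP; rewrite addr_eq0 => /eqP ->.
  have -> : b00 = (a 0%N 0%N)^-1 by apply: (mulfI a0); rewrite e1 mulfV.
  by field.
Qed.

Lemma analytic2_quadratic f p dx dy : analytic2 f p dx dy ->
  exists K r : R, [/\ 0 <= K, 0 < r & forall h k m,
    cabs h <= m -> cabs k <= m -> m < r ->
    cabs (f (p.1 + h, p.2 + k) - f p - (dx * h + dy * k)) <= K * m ^+ 2].
Proof.
move=> [a [r [M [ea a1 a2]]]].
have f0 := expansion2_value ea.
have [r0 aM fs] := ea.
have M0 : 0 <= M by apply: le_trans (aM 0%N 0%N); rewrite mulr1 cabs_ge0.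
exists (8 * M / r ^+ 2), (r / 4); split=> [||h k m hm km mr].
- by rewrite !mulr_ge0// invr_ge0 exprn_ge0// ltW.
- by rewrite divr_gt0.
have m0 : 0 <= m := le_trans (cabs_ge0 h) hm.
have mr4 : m / r < 4^-1 by rewrite ltr_pdivrMr// mulrC.
have mr0 : 0 <= m / r by rewrite divr_ge0// ltW.
have q01 : 0 <= 2 * (m / r) < 1 by apply/andP; split; lra.
have hr : cabs h < r by apply: le_lt_trans hm _; lra.
have kr : cabs k < r by apply: le_lt_trans km _; lra.
have := has_sum_tail 2 q01 (fun n => diag_monom_le n r0 aM hm km) (fs h k hr kr).
rewrite /series/= big_nat_recr//= big_nat1 /diag big_ord1 !big_ord_recl big_ord0 /monom /=.
rewrite !mulr1 !expr1 addr0 a1 a2 -f0 opprD addrA [dy * k + _]addrC => /le_trans; apply.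
have -> : 8 * M / r ^+ 2 * m ^+ 2 = M * (2 * (m / r)) ^+ 2 * 2.
  by rewrite !exprMn exprVn; ring.
rewrite ler_wpM2l ?mulr_ge0 ?exprn_ge0 ?mulr_ge0 ?invr_ge0 ?(ltW r0)//.
by rewrite -[leRHS]invrK lef_pV2 ?posrE; lra.
Qed.

End AnalyticTwo.

Section Differential.
Variable R : realType.
Local Notation C := (CC R).
Local Notation C2 := (CC R * CC R)%type.

Definition lin2 (dx dy : C) (v : C2) : C := dx * v.1 + dy * v.2.

Lemma lin2_is_linear dx dy : linear (lin2 dx dy).
Proof. by move=> c u v; rewrite /lin2 /= /GRing.scale /=; ring. Qed.

HB.instance Definition _ dx dy :=
  GRing.isLinear.Build C C2 C _ (lin2 dx dy) (@lin2_is_linear dx dy).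

Lemma lin2_continuous dx dy : continuous (lin2 dx dy).
Proof.
move=> v; apply: cvgD; apply: cvgM; try exact: cvg_cst.
  exact: cvg_fst.
exact: cvg_snd.
Qed.

Lemma norm_pairE (v : C2) : `|v| = (Num.max (cabs v.1) (cabs v.2))%:C.
Proof.
rewrite prod_normE !normE /Num.max /Order.max ltcR.
by case: ifP.
Qed.

(** This is what connects power series to the differential ['d f p]. *)
Lemma analytic2_diff (f : C2 -> C) p dx dy : analytic2 f p dx dy ->
  differentiable f p /\ forall v, 'd f p v = dx * v.1 + dy * v.2.
Proof.
move=> /analytic2_quadratic [K [r [K0 r0 hK]]].
have o : f \o shift p = cst (f p) + lin2 dx dy +o_ (0 : C2) id.
  apply/eqaddoP => _ /posC_real[e e0 ->].
  have d0 : 0 < Num.min r (e / (K + 1)) by rewrite lt_min r0 divr_gt0// ltr_wpDl.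
  apply/nbhs_ballP; exists (Num.min r (e / (K + 1)))%:C; first by rewrite /= ltcR.
  move=> v; rewrite -ball_normE /= sub0r normrN norm_pairE ltcR => vm.
  rewrite normE -rmorphM lecR.
  move: vm; rewrite lt_min; set m := Num.max _ _ => /andP[mr me].
  have h1 : cabs v.1 <= m by rewrite le_max lexx.
  have h2 : cabs v.2 <= m by rewrite le_max lexx orbT.
  have m0 : 0 <= m := le_trans (cabs_ge0 _) h1.
  have := hK _ _ _ h1 h2 mr.
  have -> : (p.1 + v.1, p.2 + v.2) = v + p by rewrite [v + p]addrC.
  rewrite -[_ - f p - _]addrA -opprD => hh.
  apply: (@le_trans _ _ (K * m ^+ 2)); first exact: hh.
  rewrite expr2 mulrA ler_wpM2r//.
  move: me; rewrite ltr_pdivlMr ?ltr_wpDl// => me.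
  by apply: le_trans (ltW me); rewrite mulrC ler_wpM2l// lerDl.
have dE : 'd f p = lin2 dx dy :> (C2 -> C).
  exact: (@diff_unique _ _ _ f (lin2 dx dy) p (@lin2_continuous dx dy) o).
split; last by move=> v; rewrite dE.
apply/diff_locallyP; rewrite dE; split=> //; exact: lin2_continuous.
Qed.

End Differential.

(** * The reciprocal of Gamma near the nonnegative integers *)

Section GammaFunction.
Variable R : realType.
Local Notation C := (CC R).
Implicit Types (z w d : C).

(** The bound [1 / 2] on the sum is what lets the factor [2] survive the
    induction. *)
Lemma prod_near1 (e : nat -> C) (t : nat -> R) N : (forall k, cabs (e k) <= t k) ->
  \sum_(0 <= k < N) t k <= 2^-1 ->
  cabs (\prod_(k < N) (1 + e k) - 1) <= 2 * \sum_(0 <= k < N) t k.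
Proof.
move=> et; have t0 k : 0 <= t k := le_trans (cabs_ge0 _) (et k).
elim: N => [|N IH]; first by rewrite big_ord0 big_nil subrr cabs0 mulr0.
rewrite big_nat_recr//= big_ord_recr/= => T2.
have {}IH : cabs (\prod_(k < N) (1 + e k) - 1) <= 2 * \sum_(0 <= k < N) t k.
  by apply: IH; have := t0 N; lra.
set P := \prod_(k < N) _ in IH *; set S := \sum_(0 <= k < N) t k in IH T2 *.
have -> : P * (1 + e N) - 1 = (P - 1) + (P - 1) * e N + e N by ring.
apply: le_trans (cabsD _ _) _; apply: le_trans (lerD (cabsD _ _) (et N)) _.
rewrite cabsM; have := ler_pM (cabs_ge0 _) (cabs_ge0 _) IH (et N).
have S0 : 0 <= S by apply: sumr_ge0.
have := t0 N; nra.
Qed.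

(** Compared with the telescoping sum of [2 * (1 / k - 1 / (k + 1))]. *)
Lemma sum_inv_sqr_le N : \sum_(0 <= k < N) (k.+1%:R ^+ 2)^-1 <= (2 : R).
Proof.
suff : \sum_(0 <= k < N) (k.+1%:R ^+ 2)^-1 <= 2 * (1 - N.+1%:R^-1) :> R.
  by move/le_trans; apply; rewrite ler_piMr// gerBl invr_ge0.
elim: N => [|N IH]; first by rewrite big_nil invr1; lra.
rewrite big_nat_recr//=; apply: le_trans (lerD IH (lexx _)) _.
have x1 : 1 <= N.+1%:R :> R by rewrite ler1n.
rewrite -[N.+2%:R]natr1; move: N.+1%:R x1 => x x1.
have -> : 2 * (1 - (x + 1)^-1) = 2 * (1 - x^-1) + x^-1 * (2 / (x + 1)).
  by field; apply/andP; split; lra.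
rewrite lerD2l expr2 invfM ler_wpM2l ?invr_ge0//; first by lra.
by rewrite ler_pdivlMr ?ler_pdivrMl; lra.
Qed.

(** The partial products stay bounded by [2], so their increments are dominated by
    the summable [2 * t k]. *)
Lemma cvg_infinite_prod (e : nat -> C) (t : nat -> R) (T : R) :
  (forall k, cabs (e k) <= t k) ->
  (forall N, \sum_(0 <= k < N) t k <= T) -> T <= 2^-1 ->
  exists2 P : C, (fun N => \prod_(k < N) (1 + e k)) @ \oo --> P &
    cabs (P - 1) <= 2 * T.
Proof.
move=> et tT T2; have t0 k : 0 <= t k := le_trans (cabs_ge0 _) (et k).
pose P N := \prod_(k < N) (1 + e k).
have P1 N : cabs (P N - 1) <= 2 * T.
  apply: le_trans (prod_near1 et _) _; first exact: le_trans (tT N) T2.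
  by rewrite ler_wpM2l.
have dP N : cabs (P N.+1 - P N) <= 2 * t N.
  rewrite /P big_ord_recr/= mulrDr mulr1 addrAC subrr add0r cabsM.
  have : cabs (P N) <= 2.
    by rewrite -(subrK 1 (P N)); apply: le_trans (cabsD _ _) _; rewrite cabs1; have := P1 N; lra.
  by move=> h; rewrite ler_pM ?cabs_ge0.
have ct : cvg (series (fun N => 2 * t N) @ \oo).
  apply: nondecreasing_is_cvgn.
    by apply: nondecreasing_series => n _ _; rewrite mulr_ge0.
  by exists (2 * T) => _ [N _ <-]; rewrite /series/= -mulr_sumr ler_wpM2l.
have [l [hl] _] := dominated_has_sum dP ct.
have PE N : P N = 1 + series (fun N => P N.+1 - P N) N.
  elim: N => [|N IH]; first by rewrite /P big_ord0 /series/= big_nil addr0.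
  rewrite /series/= big_nat_recr//= addrA.
  by move: IH; rewrite /series/= => <-; rewrite addrC subrK.
have cP : P @ \oo --> 1 + l.
  rewrite (_ : P = fun N => 1 + series (fun N => P N.+1 - P N) N); last exact/funext.
  by apply: cvgD hl; exact: cvg_cst.
exists (1 + l) => //.
have cn : (fun N => cabs (P N - 1)) @ \oo --> cabs (1 + l - 1).
  have c1 : (fun N => P N - 1) @ \oo --> 1 + l - 1 by exact: cvgB cP (cvg_cst _).
  exact: cvg_cabs_norm c1.
rewrite -(cvg_lim _ cn)//; apply: limr_le; first exact: cvgP cn.
by apply: nearW => N; exact: P1.
Qed.

Definition weierstrass_factor w := (1 + w) * cexp (- w).

(** The first-order terms of [1 + w] and [exp (- w)] cancel. *)
Lemma weierstrass_factor_quadratic : exists K r : R, [/\ 0 <= K, 0 < r &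
  forall w, cabs w < r -> cabs (weierstrass_factor w - 1) <= K * cabs w ^+ 2].
Proof.
have h1 := cdiff_linear 1 1 (0 : C).
have h2 := cdiff_comp (cdiff_linear (-1) 0 (0 : C)) (cdiff_cexp _).
have [K [r [K0 r0 hK]]] := cdiffM h1 h2.
exists K, r; split=> // w /hK.
rewrite !mulr0 !add0r !addr0 mul1r mulN1r cexp0 /weierstrass_factor.
by rewrite !mul1r addNr mul0r subr0 [w + 1]addrC.
Qed.

Definition euler_seq (n : nat) : R := \sum_(k < n.+1) k.+1%:R^-1 - ln n%:R.

(** With [ln (n + 1)] in place of [ln n] the sequence is nonincreasing and
    nonnegative, by the inequality [ln (1 + x) <= x]. *)
Lemma cvg_euler_seq : exists g : R, euler_seq @ \oo --> g.
Proof.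
pose D (m : nat) : R := \sum_(k < m.+1) k.+1%:R^-1 - ln m.+1%:R.
have p (m : nat) : 0 < m.+1%:R :> R by rewrite ltr0n.
have Dn m : D m.+1 <= D m.
  rewrite /D big_ord_recr/=.
  have := @le_ln1Dx R (- m.+2%:R^-1) _.
  rewrite ltrN2 invf_lt1 ?ltr1n// => /(_ isT).
  have -> : 1 - m.+2%:R^-1 = m.+1%:R / m.+2%:R :> R.
    rewrite -[m.+2%:R]natr1; move: m.+1%:R (p m) => x x0.
    by field; lra.
  rewrite ln_div ?posrE//; move: (ln m.+1%:R) (ln m.+2%:R) (m.+2%:R^-1) => a b c.
  by set S := \sum_(k < _) _; lra.
have D0 m : 0 <= D m.
  suff : ln m.+2%:R <= \sum_(k < m.+1) k.+1%:R^-1 :> R.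
    rewrite subr_ge0; apply: le_trans; rewrite ler_ln ?posrE// ler_nat//.
  elim: m => [|m IH].
    rewrite big_ord1 invr1 -[2]/(1 + 1); apply: le_ln1Dx; lra.
  rewrite big_ord_recr/=; apply: le_trans (lerD IH (lexx _)).
  have := @le_ln1Dx R m.+2%:R^-1 _; rewrite (lt_trans (ltrN10 _)) ?invr_gt0// => /(_ isT).
  have -> : 1 + m.+2%:R^-1 = m.+3%:R / m.+2%:R :> R.
    rewrite -[m.+3%:R]natr1; move: m.+2%:R (p m.+1) => x x0.
    by field; lra.
  rewrite ln_div ?posrE//; move: (ln m.+2%:R) (ln m.+3%:R) (m.+2%:R^-1) => a b c.
  by lra.
have cD : cvgn D.
  apply: nonincreasing_is_cvgn; last by exists 0 => _ [m _ <-].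
  by apply/nonincreasing_seqP.
have [g hg] : exists g : R, D @ \oo --> g by exists (limn D).
exists g.
have h0 : (fun m => harmonic m.+1 : R) @ \oo --> 0.
  by rewrite (cvg_shiftS (harmonic : R^nat)); exact: cvg_harmonic.
have hs : (fun m => D m + harmonic m.+1) @ \oo --> g.
  by rewrite -[g]addr0; exact: cvgD hg h0.
have : (fun m => euler_seq m.+1) @ \oo --> g.
  by apply: cvg_ext hs => m; rewrite /euler_seq /D /= [in RHS]big_ord_recr /= addrAC.
by move=> h; rewrite -(cvg_shiftS euler_seq); exact: h.
Qed.

Definition euler_gauss z (n : nat) : C :=
  n`!%:R * cexp (z * (ln (n%:R : R))%:C) / \prod_(k < n.+1) (z + k%:R).

Definition weierstrass_prod d n := \prod_(k < n) weierstrass_factor (d / k.+1%:R).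

Lemma weierstrass_prodE d n : weierstrass_prod d n =
  \prod_(k < n) (1 + d / k.+1%:R) * cexp (- (d * (\sum_(k < n) (k.+1%:R)^-1 : R)%:C)).
Proof.
elim: n => [|n IH]; first by rewrite /weierstrass_prod !big_ord0 mulr0 oppr0 cexp0 mulr1.
rewrite /weierstrass_prod big_ord_recr/= -/(weierstrass_prod d n) IH.
rewrite !big_ord_recr/=; set S := \sum_(k < n) _.
have -> : - (d * (S + n.+1%:R^-1)%:C) = - (d * S%:C) - d / n.+1%:R.
  by rewrite rmorphD /= mulrDr opprD fmorphV rmorph_nat.
by rewrite cexpD /weierstrass_factor; ring.
Qed.

(** The factorials cancel and [n ^ d] is split between the harmonic sum hidden in
    the Weierstrass product and its difference with the logarithm. *)
Lemma euler_gauss1D d n : (0 < n)%N -> euler_gauss (1 + d) n =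
  n%:R / n.+1%:R * cexp (- (d * (euler_seq n)%:C)) / weierstrass_prod d n.+1.
Proof.
move=> n0; have n0' : n%:R != 0 :> C by rewrite pnatr_eq0 -lt0n.
have f0 m : m`!%:R != 0 :> C by rewrite pnatr_eq0 -lt0n fact_gt0.
have prodE m : \prod_(k < m) (1 + d + k%:R) = m`!%:R * \prod_(k < m) (1 + d / k.+1%:R).
  elim: m => [|m IH]; first by rewrite !big_ord0 mulr1.
  rewrite !big_ord_recr/= IH factS natrM.
  have m0 : m.+1%:R != 0 :> C by rewrite pnatr_eq0.
  have -> : 1 + d + m%:R = m.+1%:R * (1 + d / m.+1%:R).
    by rewrite mulrDr mulrCA mulfV// !mulr1 (mulrSr 1 m); ring.
  ring.
rewrite /euler_gauss prodE weierstrass_prodE factS natrM mulrDl mul1r cexpD.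
rewrite cexp_real lnK ?posrE ?ltr0n// rmorph_nat.
rewrite /euler_seq; set S := \sum_(k < n.+1) _.
have -> : - (d * (S - ln n%:R)%:C) = d * (ln n%:R : R)%:C + - (d * S%:C).
  by rewrite rmorphB /= mulrBr opprB.
rewrite cexpD; have b0 := cexp_neq0 (- (d * S%:C)).
move: (\prod_(k < n.+1) _) (cexp (- (d * S%:C))) b0 (cexp (d * _)) => P b b0 a.
have -> : n`!%:R * (n%:R * a) / (n.+1%:R * n`!%:R * P) =
    n%:R / n.+1%:R * a / P * (n`!%:R / n`!%:R) by rewrite !invfM; ring.
have -> : n%:R / n.+1%:R * (a * b) / (P * b) =
    n%:R / n.+1%:R * a / P * (b / b) by rewrite !invfM; ring.
by rewrite !mulfV.
Qed.

Lemma cvg_natr_ratio z : (fun n => (n.+1%:R + z) / n.+1%:R) @ \oo --> (1 : C).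
Proof.
apply: (@cvg_cabs_le _ _ _ _ _ _ (fun n => cabs z * harmonic n)).
  apply: nearW => n; have n0 : n.+1%:R != 0 :> C by rewrite pnatr_eq0.
  rewrite mulrDl mulfV// addrAC subrr add0r cabsM cabsV cabs_nat; exact: lexx.
rewrite -(mulr0 (cabs z)); apply: cvgM; first exact: cvg_cst.
exact: cvg_harmonic.
Qed.

(** For a small increment the product over [k] of
    [(1 + d / k) exp (- d / k)] converges and differs from [1] by [O(d ^ 2)]:
    the Euler constant is the only first-order term of the reciprocal of
    Gamma at [1]. *)
Lemma cvg_weierstrass_prod : exists K r : R, [/\ 0 <= K, 0 < r &
  forall d, cabs d < r -> exists P : C, [/\ P != 0,
    (weierstrass_prod d) @ \oo --> P & cabs (P - 1) <= K * cabs d ^+ 2]].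
Proof.
have [K [r [K0 r0 hK]]] := weierstrass_factor_quadratic.
pose q : R := (8 * (K + 1))^-1.
have q0 : 0 < q by rewrite invr_gt0 mulr_gt0// ltr_wpDl.
exists (4 * K), (Num.min r (Num.min 1 q)).
split=> [||d]; [by rewrite mulr_ge0|by rewrite !lt_min r0 ltr01|].
rewrite !lt_min => /and3P[dr d1 dq].
have dk k : cabs (d / k.+1%:R) = cabs d / k.+1%:R by rewrite cabsM cabsV cabs_nat.
have dle k : cabs (d / k.+1%:R) <= cabs d.
  by rewrite dk ler_pdivrMr ?ltr0n// ler_peMr ?cabs_ge0// ler1n.
pose e k := weierstrass_factor (d / k.+1%:R) - 1.
pose t k := K * cabs d ^+ 2 * (k.+1%:R ^+ 2)^-1.
have et k : cabs (e k) <= t k.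
  apply: le_trans (hK _ (le_lt_trans (dle k) dr)) _.
  by rewrite dk exprMn exprVn mulrA.
have tT N : \sum_(0 <= k < N) t k <= K * cabs d ^+ 2 * 2.
  by rewrite -mulr_sumr ler_wpM2l ?mulr_ge0 ?exprn_ge0 ?cabs_ge0// sum_inv_sqr_le.
have T2 : 2 * (K * cabs d ^+ 2 * 2) < 1.
  have h1 : cabs d ^+ 2 <= cabs d by rewrite expr2 ler_piMl ?cabs_ge0// ltW.
  have h2 : K * cabs d ^+ 2 <= K * cabs d by rewrite ler_wpM2l.
  have h3 : (K + 1) * cabs d < 8^-1.
    rewrite -(ltr_pM2l (_ : 0 < K + 1)) ?ltr_wpDl// in dq.
    apply: lt_le_trans dq _; rewrite /q invfM mulrCA mulfV ?mulr1//.
    by rewrite gt_eqF// ltr_wpDl.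
  have := cabs_ge0 d; lra.
have [|P hP P1] := cvg_infinite_prod et tT; first by lra.
exists P; split; last 1 first.
- by apply: le_trans P1 _; lra.
- apply/eqP => P0; move: P1; rewrite P0 sub0r cabsN cabs1; lra.
- apply: cvg_ext hP => N; apply: eq_bigr => k _.
  by rewrite /e addrC subrK.
Qed.


Lemma cvg_CR (u : nat -> R) (l : R) : u @ \oo --> l ->
  (fun n => (u n)%:C : C) @ \oo --> (l%:C : C).
Proof.
move=> ul; apply/cvg_cabs; apply: (cvg_ext (f := fun n => `|u n - l|)).
  by move=> n; rewrite -rmorphB cabsR.
rewrite -(normr0 R) -(subrr l); apply: cvg_norm; apply: cvgB ul _; exact: cvg_cst.
Qed.

Lemma cexp_continuous : continuous (@cexp R).
Proof.
move=> z; have [K [r [K0 r0 hK]]] := cdiff_cexp z.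
apply: (@cvg_cabs_le R _ (nbhs (z : C)) _ _ _ (fun w => (cabs (cexp z) + K) * cabs (w - z))).
  near=> w; have hr : cabs (w - z) < Num.min 1 r.
    near: w; apply/nbhs_ballP; exists (Num.min 1 r)%:C.
      by rewrite /= ltcR lt_min ltr01.
    by move=> y /=; rewrite /ball/= norm_ltC.
  move: hr; rewrite lt_min => /andP[h1 hr].
  by have := cdiff_increment K0 h1 (hK _ hr); rewrite [z + _]addrC subrK.
rewrite -(mulr0 (cabs (cexp z) + K)); apply: cvgM; first exact: cvg_cst.
by apply/cvg_cabs; exact: cvg_id.
Unshelve. all: by end_near. Qed.

Lemma cvg_euler_gauss1D (g : R) d (P : C) : euler_seq @ \oo --> g ->
  weierstrass_prod d @ \oo --> P -> P != 0 ->
  euler_gauss (1 + d) @ \oo --> (cexp (d * g%:C) * P)^-1.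
Proof.
move=> hg hP P0; rewrite -(cvg_shiftS (euler_gauss (1 + d))).
have h1 : (fun n => n.+1%:R / n.+2%:R) @ \oo --> (1 : C).
  have h : (fun n => ((n.+1%:R + 1) / n.+1%:R)^-1) @ \oo --> (1^-1 : C).
    exact: cvgV (@oner_neq0 C) (cvg_natr_ratio (1 : C)).
  rewrite invr1 in h.
  by apply: cvg_ext h => n; rewrite invf_div natr1.
have h2 : (fun n => cexp (- (d * (euler_seq n.+1)%:C))) @ \oo --> cexp (- (d * g%:C)).
  apply: continuous_cvg; first exact: cexp_continuous.
  apply: cvgN; apply: cvgM; first exact: cvg_cst.
  by apply: cvg_CR; move: hg; rewrite -cvg_shiftS.
have h3 : (fun n => weierstrass_prod d n.+2) @ \oo --> P.
  by move: hP; rewrite -cvg_shiftS -cvg_shiftS.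
have h4 : (fun n => (weierstrass_prod d n.+2)^-1) @ \oo --> P^-1.
  exact: cvgV P0 h3.
have h : (fun n => n.+1%:R / n.+2%:R * cexp (- (d * (euler_seq n.+1)%:C)) *
    (weierstrass_prod d n.+2)^-1) @ \oo --> 1 * cexp (- (d * g%:C)) / P.
  exact: cvgM (cvgM h1 h2) h4.
rewrite mul1r cexpN -invfM in h.
have : (fun n => euler_gauss (1 + d) n.+1) @ \oo --> (cexp (d * g%:C) * P)^-1.
  by apply: cvg_ext h => n; rewrite euler_gauss1D.
by [].
Qed.

(** The functional equation of Gamma, before the limit. *)
Lemma euler_gauss_shift z n : z != 0 -> z + n.+1%:R != 0 -> (0 < n)%N ->
  euler_gauss z n = euler_gauss (z + 1) n * ((n.+1%:R + z) / n%:R) / z.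
Proof.
move=> z0 zn n0; have n0' : n%:R != 0 :> C by rewrite pnatr_eq0 -lt0n.
have e : z * \prod_(k < n.+1) (z + 1 + k%:R) = \prod_(k < n.+1) (z + k%:R) * (z + n.+1%:R).
  transitivity (\prod_(k < n.+2) (z + k%:R)); last by rewrite big_ord_recr.
  rewrite [RHS]big_ord_recl/= addr0; congr (_ * _).
  by apply: eq_bigr => k _; rewrite -addrA nat1r.
rewrite /euler_gauss.
have -> : \prod_(k < n.+1) (z + k%:R) = z * \prod_(k < n.+1) (z + 1 + k%:R) / (z + n.+1%:R).
  by rewrite e mulfK.
rewrite mulrDl mul1r cexpD cexp_real lnK ?posrE ?ltr0n// rmorph_nat.
rewrite [n.+1%:R + z]addrC; move: (\prod_(k < n.+1) _) (cexp _) (z + n.+1%:R) => P a w.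
rewrite !invfM invrK.
have -> : n`!%:R * (a * n%:R) / P * (w / n%:R) / z = n`!%:R * a / P * w / z * (n%:R / n%:R).
  by ring.
by rewrite mulfV// mulr1; ring.
Qed.


Lemma cvg_euler_gauss_down z (l : C) : z != 0 ->
  euler_gauss (z + 1) @ \oo --> l -> euler_gauss z @ \oo --> l / z.
Proof.
move=> z0 hl.
have h1 : (fun n => (n.+2%:R + z) / n.+1%:R) @ \oo --> (1 : C).
  apply: cvg_ext (cvg_natr_ratio (z + 1)) => n.
  by rewrite -[n.+2%:R]natr1 -addrA [1 + z]addrC.
have h2 : (fun n => euler_gauss (z + 1) n.+1) @ \oo --> l.
  by move: hl; rewrite -(cvg_shiftS (euler_gauss (z + 1))).
have h : (fun n => euler_gauss (z + 1) n.+1 * ((n.+2%:R + z) / n.+1%:R) / z) @ \oo -->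
    l * 1 / z.
  exact: cvgM (cvgM h2 h1) (cvg_cst _).
rewrite mulr1 in h; rewrite -(cvg_shiftS (euler_gauss z)).
have : (fun n => euler_gauss z n.+1) @ \oo --> l / z; last by [].
apply: cvg_near_eq h; near=> n; rewrite [RHS]euler_gauss_shift//.
have : (Num.truncn (cabs z) < n)%N by near: n; exact: nbhs_infty_gt.
rewrite truncn_lt_nat ?cabs_ge0// => nz; rewrite addr_eq0; apply/eqP => e.
by move: nz; rewrite e cabsN cabs_nat ltr_nat => /ltnW; rewrite ltnNge => /negP; apply; lia.
Unshelve. all: by end_near. Qed.

Lemma cvg_euler_gauss_up z (l : C) : z != 0 ->
  euler_gauss z @ \oo --> l -> euler_gauss (z + 1) @ \oo --> z * l.
Proof.
move=> z0 hl.
have h1 : (fun n => ((n.+2%:R + z) / n.+1%:R)^-1) @ \oo --> (1^-1 : C).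
  apply: cvgV; first exact: oner_neq0.
  apply: cvg_ext (cvg_natr_ratio (z + 1)) => n.
  by rewrite -[n.+2%:R]natr1 -addrA [1 + z]addrC.
have h2 : (fun n => euler_gauss z n.+1) @ \oo --> l.
  by move: hl; rewrite -(cvg_shiftS (euler_gauss z)).
have h : (fun n => z * euler_gauss z n.+1 * ((n.+2%:R + z) / n.+1%:R)^-1) @ \oo -->
    z * l * 1^-1.
  exact: cvgM (cvgM (cvg_cst _) h2) h1.
rewrite invr1 mulr1 in h; rewrite -(cvg_shiftS (euler_gauss (z + 1))).
have : (fun n => euler_gauss (z + 1) n.+1) @ \oo --> z * l; last by [].
apply: cvg_near_eq h; near=> n.
have zn : z + n.+2%:R != 0.
  have : (Num.truncn (cabs z) < n)%N by near: n; exact: nbhs_infty_gt.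
  rewrite truncn_lt_nat ?cabs_ge0// => nz; rewrite addr_eq0; apply/eqP => e.
  by move: nz; rewrite e cabsN cabs_nat ltr_nat; lia.
rewrite euler_gauss_shift// invf_div [n.+2%:R + z]addrC.
have n0 : n.+1%:R != 0 :> C by rewrite pnatr_eq0.
move: (z + _) zn (_%:R : C) n0 (euler_gauss _ _) => w w0 m m0 a.
by field; rewrite ?w0 ?m0 ?z0.
Unshelve. all: by end_near. Qed.

(** [recip_gamma j d] is the ratio of [1 / Gamma (d + j)] to
    [1 / Gamma (d + 1)]; at [j = 0] it takes the zero of [1 / Gamma] into
    account. *)
Definition recip_gamma j d : C :=
  if j is i.+1 then (\prod_(k < i) (d + k.+1%:R))^-1 else d.

Lemma cabs_lt1_addn d n : cabs d < 1 -> d + n.+1%:R != 0.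
Proof.
move=> d1; rewrite addr_eq0; apply: contraTneq d1 => ->.
by rewrite cabsN cabs_nat -leNgt ler1n.
Qed.

Lemma recip_gammaS j d : cabs d < 1 ->
  recip_gamma j d = (d + j%:R) * recip_gamma j.+1 d.
Proof.
move=> d1; case: j => [|j]; first by rewrite /recip_gamma big_ord0 invr1 addr0 mulr1.
rewrite /recip_gamma big_ord_recr/= invfM mulrCA mulfV ?mulr1//.
exact: cabs_lt1_addn.
Qed.

Lemma Gamma_lim z (l : C) : euler_gauss z @ \oo --> l -> Gamma z = l.
Proof. by move=> h; apply: cvg_lim => //; exact: CC_hausdorff. Qed.

Lemma Gamma0 : Gamma (0 : C) = 0.
Proof.
apply: Gamma_lim; apply: cvg_ext (cvg_cst (0 : C)) => n.
by rewrite /euler_gauss big_ord_recl /= addr0 [X in _ / X]mul0r invr0 mulr0.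
Qed.

(** All values of [1 / Gamma] near a nonnegative integer are obtained from the single function
    [G d = 1 / Gamma (1 + d)], for which only the value and the derivative at the
    origin matter. *)
Lemma recip_GammaE : exists (G : C -> C) (g : C) (r : R),
  [/\ 0 < r < 1, G 0 = 1, cdiff G 0 g &
   forall d j, cabs d < r -> (Gamma (d + j%:R))^-1 = G d * recip_gamma j d].
Proof.
have [g hg] := cvg_euler_seq.
have [K [r [K0 r0 hK]]] := cvg_weierstrass_prod.
pose Q d := lim (weierstrass_prod d @ \oo).
have QE d : cabs d < r -> [/\ Q d != 0, weierstrass_prod d @ \oo --> Q d &
    cabs (Q d - 1) <= K * cabs d ^+ 2].
  move=> /hK [P [P0 hP PK]]; suff -> : Q d = P by [].
  by apply: cvg_lim => //; exact: CC_hausdorff.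
have Q0 : Q 0 = 1.
  have [_ _] := QE 0 (eq_ind_r (fun x => x < r) r0 (cabs0 R)).
  rewrite cabs0 expr0n mulr0 => h; apply/eqP; rewrite -subr_eq0 -cabs_eq0.
  by rewrite eq_le h cabs_ge0.
have dQ : cdiff Q 0 0.
  exists K, r; split=> // h hr; rewrite add0r Q0 mul0r subr0.
  by have [_ _] := QE h hr.
have dE := cdiff_comp (cdiff_linear g%:C 0 (0 : C)) (cdiff_cexp _).
pose G d := cexp (g%:C * d + 0) * Q d.
exists G, g%:C, (Num.min r 2^-1); split.
- by rewrite lt_min r0 invr_gt0 ltr0n gt_min; apply/orP; right; lra.
- by rewrite /G mulr0 addr0 cexp0 Q0 mulr1.
- have := cdiffM dE dQ; rewrite !mulr0 !addr0 cexp0 Q0 add0r !mul1r; exact.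
move=> d j; rewrite lt_min => /andP[dr d2].
have d1 : cabs d < 1 by lra.
have [Qn0 hQ _] := QE d dr.
have Gn0 : G d != 0 by rewrite mulf_neq0 ?cexp_neq0.
have base : euler_gauss (d + 1) @ \oo --> (G d)^-1.
  by rewrite [d + 1]addrC /G addr0 [g%:C * d]mulrC; exact: cvg_euler_gauss1D.
have up i : euler_gauss (d + i.+1%:R) @ \oo --> (G d * recip_gamma i.+1 d)^-1.
  elim: i => [|i IH]; first by rewrite /recip_gamma big_ord0 invr1 mulr1.
  have h := cvg_euler_gauss_up (cabs_lt1_addn i d1) IH.
  have -> : d + i.+2%:R = d + i.+1%:R + 1 by rewrite -addrA natr1.
  have -> // : (G d * recip_gamma i.+2 d)^-1 =
    (d + i.+1%:R) / (G d * recip_gamma i.+1 d).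
  rewrite [in RHS]recip_gammaS// mulrCA [in RHS]invfM mulrA mulfV ?mul1r//.
  exact: cabs_lt1_addn.
case: j => [|j]; last by rewrite (Gamma_lim (up j)) invrK.
rewrite addr0; have [->|d0] := eqVneq d 0; first by rewrite Gamma0 invr0 mulr0.
by rewrite (Gamma_lim (cvg_euler_gauss_down d0 base)) invf_div invrK mulrC.
Qed.

End GammaFunction.

(** * The power series of the Bessel functions *)

Section BesselSeries.
Variable R : realType.
Local Notation C := (CC R).
Implicit Types (c e : nat -> C) (d y : C).

(** [rgamma0 j] and [rgamma1 j] are the value and the derivative at the origin of
    [recip_gamma j]; the recursions come from comparing the two sides of
    [recip_gamma j d = (d + j) * recip_gamma j.+1 d]. *)
Definition rgamma0 j : C := if j is i.+1 then i`!%:R^-1 else 0.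

(** For [i = 0] the quotient is [x / 0 = 0], the derivative of the constant
    [recip_gamma 1]. *)
Fixpoint rgamma1 j : C :=
  if j is i.+1 then (rgamma1 i - rgamma0 i.+1) / i%:R else 1.

Lemma rgamma1E j : rgamma1 j.+1 = (rgamma1 j - rgamma0 j.+1) / j%:R.
Proof. by []. Qed.

Lemma rgamma0S j : rgamma0 j = j%:R * rgamma0 j.+1.
Proof.
case: j => [|j]; first by rewrite mul0r.
by rewrite /rgamma0 factS natrM invfM mulrA mulfV ?mul1r// pnatr_eq0.
Qed.

Lemma rgamma1S j : rgamma1 j = rgamma0 j.+1 + j%:R * rgamma1 j.+1.
Proof.
case: j => [|j]; first by rewrite mul0r addr0 /= invr1.
by rewrite [rgamma1 j.+2]/= mulrC divfK ?pnatr_eq0// addrC subrK.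
Qed.

Lemma cabs_rgamma0 j : cabs (rgamma0 j) <= 1.
Proof.
case: j => [|j]; first by rewrite cabs0.
by rewrite cabsV cabs_nat invf_le1 ?ltr0n ?fact_gt0// ler1n fact_gt0.
Qed.

Lemma cabs_rgamma1 j : cabs (rgamma1 j) <= j.+1%:R.
Proof.
elim: j => [|j IH]; first by rewrite cabs1.
rewrite rgamma1E cabsM cabsV cabs_nat; case: j IH => [|j] IH.
  by rewrite invr0 mulr0.
rewrite ler_pdivrMr ?ltr0n//; apply: le_trans (cabsB _ _) _.
apply: le_trans (lerD IH (cabs_rgamma0 _)) _.
by rewrite natr1 ler_peMr// ler1n.
Qed.

Lemma recip_gamma_expansion j d : cabs d <= 2^-1 ->
  cabs (recip_gamma j d - rgamma0 j - rgamma1 j * d) <= 4 ^+ j * cabs d ^+ 2.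
Proof.
move=> d2; have d1 : cabs d < 1 by lra.
have D0 : 0 <= cabs d ^+ 2 by rewrite exprn_ge0 ?cabs_ge0.
elim: j => [|j IH]; first by rewrite /= subr0 mul1r subrr cabs0 mulr_ge0.
case: j IH => [|j] IH.
  by rewrite /= big_ord0 invr1 invr0 mulr0 mul0r subr0 subrr cabs0 mulr_ge0.
have n0 : d + j.+1%:R != 0 by exact: cabs_lt1_addn.
have nb : 2^-1 <= cabs (d + j.+1%:R).
  have := cabs_triangle j.+1%:R (- d); rewrite cabs_nat cabsN opprK [_ + d]addrC.
  have : 1 <= j.+1%:R :> R by rewrite ler1n.
  lra.
have e : recip_gamma j.+2 d - rgamma0 j.+2 - rgamma1 j.+2 * d =
   (recip_gamma j.+1 d - rgamma0 j.+1 - rgamma1 j.+1 * d - rgamma1 j.+2 * d ^+ 2)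
     / (d + j.+1%:R).
  apply: (mulIf n0); rewrite divfK// (recip_gammaS j.+1 d1) (rgamma0S j.+1) (rgamma1S j.+1); ring.
rewrite e cabsM cabsV ler_pdivrMr; last by apply: lt_le_trans nb; lra.
apply: le_trans (cabsB _ _) _; rewrite cabsM cabsX.
have b : cabs (rgamma1 j.+2) * cabs d ^+ 2 <= 4 ^+ j.+1 * cabs d ^+ 2.
  rewrite ler_wpM2r//; apply: le_trans (cabs_rgamma1 _) _.
  rewrite -natrX ler_nat; elim: (j) => // n; rewrite [(4 ^ n.+2)%N]expnS; lia.
apply: le_trans (lerD IH b) _; rewrite [4 ^+ j.+2]exprS.
have x0 : 0 <= 4 ^+ j.+1 * cabs d ^+ 2 by rewrite mulr_ge0 ?exprn_ge0 ?cabs_ge0.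
rewrite -mulrA; move: (4 ^+ j.+1 * _) x0 (cabs (d + _)) nb => x x0 w nb.
by rewrite mulrAC -mulrA mulrCA; nra.
Qed.

Lemma recip_gamma_bound j d : cabs d <= 2^-1 -> cabs (recip_gamma j d) <= 3 * 4 ^+ j.
Proof.
move=> d2; have e := recip_gamma_expansion j d2.
have h1 : 1 <= 4 ^+ j :> R by rewrite exprn_ege1// ler1n.
have h2 : cabs (rgamma1 j) <= 4 ^+ j.
  apply: le_trans (cabs_rgamma1 _) _; apply: le_trans (natr_le_exp2 R j) _.
  by rewrite lerXn2r ?nnegrE//; lra.
have := cabs_rgamma0 j => h0.
have d0 := cabs_ge0 d.
have hd : 4 ^+ j * cabs d ^+ 2 <= 4 ^+ j by rewrite ler_piMr ?exprn_ge0// expr2; nra.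
have -> : recip_gamma j d = recip_gamma j d - rgamma0 j - rgamma1 j * d
    + (rgamma0 j + rgamma1 j * d) by ring.
apply: le_trans (cabsD _ _) _; apply: le_trans (lerD e (cabsD _ _)) _.
rewrite cabsM; have := cabs_ge0 (rgamma1 j); nra.
Qed.

(** Coefficients of [sum_k (-1)^k / k! * c (k + m) * y ^ k]: all the Bessel
    series below have this form, and differentiating in [y] amounts to
    incrementing [m] and changing the sign. *)
Definition bessel_coef c m k : C := (-1) ^+ k / k`!%:R * c (k + m)%N.

Definition bessel_series c m y : C :=
  lim (series (fun k => bessel_coef c m k * y ^+ k) @ \oo).

(** A growth beaten by the factorial in [bessel_coef], and large enough for the
    remainder in [recip_gamma_expansion]. *)
Definition tame c (L : R) := forall j, cabs (c j) <= L * 4 ^+ j.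

Lemma bessel_coef_bound c L m (r : R) k : 0 <= r -> tame c L ->
  cabs (bessel_coef c m k) * r ^+ k <= L * 4 ^+ m * expR (4 * r).
Proof.
move=> r0 cL; have L0 : 0 <= L.
  by have := le_trans (cabs_ge0 _) (cL 0%N); rewrite mulr1.
rewrite /bessel_coef !cabsM cabsX cabsN cabs1 expr1n mul1r cabsV cabs_nat.
have h : k`!%:R^-1 * (4 * r) ^+ k <= expR (4 * r).
  have x0 : 0 <= 4 * r by rewrite mulr_ge0.
  case: k => [|k].
    by rewrite invr1 mul1r; have := expR_ge1Dx (4 * r); lra.
  have := expR_ge1Dxn k x0; rewrite mulrC; lra.
have -> : L * 4 ^+ m * expR (4 * r) = expR (4 * r) * (L * 4 ^+ m) by ring.
apply: (@le_trans _ _ (k`!%:R^-1 * (4 * r) ^+ k * (L * 4 ^+ m))); last first.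
  by rewrite ler_wpM2r// mulr_ge0// exprn_ge0.
have -> : k`!%:R^-1 * (4 * r) ^+ k * (L * 4 ^+ m) =
    k`!%:R^-1 * (L * 4 ^+ (k + m)) * r ^+ k by rewrite exprMn exprD; ring.
by rewrite ler_wpM2r ?exprn_ge0// ler_wpM2l ?invr_ge0.
Qed.

Lemma bessel_term_bound c L m y k : tame c L ->
  cabs (bessel_coef c m k * y ^+ k) <=
  L * 4 ^+ m * expR (4 * (2 * cabs y + 1)) * 2^-1 ^+ k.
Proof.
(* This radius makes the ratio [cabs y / r] at most [1 / 2]. *)
move=> cL; have r0 : 0 < 2 * cabs y + 1 by have := cabs_ge0 y; lra.
apply: le_trans (term_bound y r0 (bessel_coef_bound m k (ltW r0) cL)) _.
have L0 : 0 <= L by have := le_trans (cabs_ge0 _) (cL 0%N); rewrite mulr1.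
rewrite ler_wpM2l ?mulr_ge0 ?exprn_ge0 ?expR_ge0//.
rewrite lerXn2r ?nnegrE ?divr_ge0 ?cabs_ge0 ?(ltW r0)// ?invr_ge0//.
by rewrite ler_pdivrMr//; lra.
Qed.

Lemma half01 : 0 <= (2^-1 : R) < 1.
Proof. by apply/andP; split; lra. Qed.

Lemma bessel_has_sum c L m y : tame c L ->
  has_sum (fun k => bessel_coef c m k * y ^+ k) (bessel_series c m y).
Proof.
move=> cL.
have [l hl _] := geometric_has_sum half01 (fun k => bessel_term_bound m y k cL).
by rewrite /bessel_series (has_sum_lim hl).
Qed.

Lemma bessel_coefS c m k : k.+1%:R * bessel_coef c m k.+1 = - bessel_coef c m.+1 k.
Proof.
rewrite /bessel_coef exprS factS natrM invfM addSnnS.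
have n0 : k.+1%:R != 0 :> C by rewrite pnatr_eq0.
have -> : k.+1%:R * (-1 * (-1) ^+ k * (k.+1%:R^-1 * k`!%:R^-1) * c (k + m.+1)%N) =
  k.+1%:R / k.+1%:R * - ((-1) ^+ k / k`!%:R * c (k + m.+1)%N) :> C by ring.
by rewrite mulfV ?mul1r.
Qed.

Lemma bessel_analytic1 c L m y : tame c L ->
  analytic1 (bessel_series c m) y (- bessel_series c m.+1 y).
Proof.
move=> cL; have r0 : 0 < cabs y + 1 by have := cabs_ge0 y; lra.
have yr : cabs y < cabs y + 1 by lra.
have [d hd] := power_series_analytic1 r0 (fun k => bessel_coef_bound m k (ltW r0) cL)
  (fun z _ => bessel_has_sum m z cL) yr.
suff -> : d = - bessel_series c m.+1 y by [].
apply: has_sum_unique hd _; rewrite -mulN1r.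
apply: has_sum_eq (has_sumZ (-1) (bessel_has_sum m.+1 y cL)) => k.
by rewrite bessel_coefS; ring.
Qed.

(** In degree [k] the part [j * c j.+1] turns [1 / k!] into [1 / (k - 1)!], and the
    change of index contributes the factor [- y]. *)
Lemma bessel_recurrence c e L y : tame c L -> tame e L ->
  (forall j, c j = e j.+1 + j%:R * c j.+1) ->
  bessel_series c 0 y = bessel_series e 1 y - y * bessel_series c 2 y.
Proof.
move=> cL eL ce.
apply: has_sum_unique (bessel_has_sum 0 y cL) _.
have h0 : has_sum (fun k => k%:R * bessel_coef c 1 k * y ^+ k) (- y * bessel_series c 2 y).
  have := @has_sum_cons _ (fun k => k%:R * bessel_coef c 1 k * y ^+ k) (- y * bessel_series c 2 y).
  rewrite !mul0r add0r; apply.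
  apply: has_sum_eq (has_sumZ (- y) (bessel_has_sum 2 y cL)) => k.
  by rewrite bessel_coefS exprS; ring.
rewrite -mulNr; apply: has_sum_eq (has_sumD (bessel_has_sum 1 y eL) h0) => k.
by rewrite /bessel_coef !addn1 addn0 (ce k); ring.
Qed.

Lemma tame_rgamma0 : tame rgamma0 1.
Proof.
by move=> j; rewrite mul1r; apply: le_trans (cabs_rgamma0 j) _; rewrite exprn_ege1// ler1n.
Qed.

Lemma tame_rgamma1 : tame rgamma1 1.
Proof.
move=> j; rewrite mul1r; apply: le_trans (cabs_rgamma1 _) _.
by apply: le_trans (natr_le_exp2 R j) _; rewrite lerXn2r ?nnegrE//; lra.
Qed.

Lemma bessel_A0E y : bessel_series rgamma0 0 y = - y * bessel_series rgamma0 2 y.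
Proof.
have t : tame (fun=> 0 : C) 1 by move=> j; rewrite cabs0 mul1r exprn_ge0.
have z : bessel_series (fun=> 0) 1 y = 0.
  apply: has_sum_unique (bessel_has_sum 1 y t) _.
  have := has_sumZ 0 (bessel_has_sum 1 y t); rewrite mul0r.
  by apply: has_sum_eq => k; rewrite /bessel_coef mulr0 !mul0r.
rewrite (bessel_recurrence y tame_rgamma0 t); first by rewrite z sub0r mulNr.
by move=> j; rewrite add0r; exact: rgamma0S.
Qed.

Lemma bessel_B0E y : bessel_series rgamma1 0 y = bessel_series rgamma0 1 y - y * bessel_series rgamma1 2 y.
Proof. exact: bessel_recurrence (tame_rgamma1) (tame_rgamma0) (rgamma1S). Qed.

Lemma bessel_series_at0 c (L : R) m : tame c L -> bessel_series c m 0 = c m.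
Proof.
move=> cL; apply: has_sum_unique (bessel_has_sum m 0 cL) _.
have z n : (1 <= n)%N -> bessel_coef c m n * 0 ^+ n = 0.
  by case: n => // n _; rewrite expr0n mulr0.
have := has_sum_finite z; rewrite [in X in has_sum _ X]/series/= big_nat1.
by rewrite {2}/bessel_coef invr1 !mulr1 mul1r add0n.
Qed.

Lemma tame_recip_gamma d : cabs d <= 2^-1 -> tame (fun j => recip_gamma j d) 3.
Proof. by move=> d2 j; exact: recip_gamma_bound. Qed.

Lemma recip_gamma_at0 j : recip_gamma j 0 = rgamma0 j.
Proof.
have := @recip_gamma_expansion j 0; rewrite cabs0 expr0n mulr0 mulr0 subr0.
move=> /(_ _) h; apply/eqP; rewrite -subr_eq0 -cabs_eq0 eq_le cabs_ge0 andbT.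
by apply: h; rewrite invr_ge0.
Qed.

(** The remainder in [d] is itself a series of the same kind, with coefficients
    bounded by [4 ^ j * cabs d ^ 2]. *)
Lemma bessel_series_cdiff_order m y :
  cdiff (fun d => bessel_series (fun j => recip_gamma j d) m y) 0 (bessel_series rgamma1 m y).
Proof.
pose B : R := 4 ^+ m * expR (4 * (2 * cabs y + 1)) / (1 - 2^-1).
exists B, 2^-1; split=> [||d dlt]; last 1 first.
- have d2 := ltW dlt; rewrite add0r.
  have -> : (fun j => recip_gamma j 0) = rgamma0 by apply/funext => j; exact: recip_gamma_at0.
  pose e j := recip_gamma j d - rgamma0 j - rgamma1 j * d.
  have eL : tame e (cabs d ^+ 2).
    by move=> j; rewrite mulrC; exact: recip_gamma_expansion.
  have h1 := bessel_has_sum m y (tame_recip_gamma d2).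
  have h2 := bessel_has_sum m y tame_rgamma0.
  have h3 := has_sumZ d (bessel_has_sum m y tame_rgamma1).
  have h4 := has_sumB (has_sumB h1 h2) h3.
  rewrite [_ * d]mulrC.
  have tb k : cabs (bessel_coef (fun j => recip_gamma j d) m k * y ^+ k -
      bessel_coef rgamma0 m k * y ^+ k - d * (bessel_coef rgamma1 m k * y ^+ k)) <=
      cabs d ^+ 2 * 4 ^+ m * expR (4 * (2 * cabs y + 1)) * 2^-1 ^+ k.
    have -> : bessel_coef (fun j => recip_gamma j d) m k * y ^+ k -
      bessel_coef rgamma0 m k * y ^+ k - d * (bessel_coef rgamma1 m k * y ^+ k) =
      bessel_coef e m k * y ^+ k by rewrite /bessel_coef /e; ring.
    exact: bessel_term_bound.
  apply: le_trans (has_sum_le half01 tb h4) _.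
  by rewrite /B le_eqVlt; apply/orP; left; apply/eqP; ring.
- by rewrite /B !mulr_ge0 ?exprn_ge0 ?expR_ge0// invr_ge0; lra.
- by rewrite invr_gt0.
Qed.

End BesselSeries.

(** * Bessel functions as functions of their order *)

Section BesselFunctions.
Variable R : realType.
Local Notation C := (CC R).
Local Notation A := (bessel_series (@rgamma0 R)).
Local Notation B := (bessel_series (@rgamma1 R)).
Implicit Types (y z nu : C) (alpha : R) (m : nat).

Lemma csqrtE alpha y : y != 0 -> csqrt alpha y = cexp (2^-1 * clog alpha y).
Proof. by move=> y0; rewrite /csqrt /cpow (negbTE y0). Qed.

Lemma csqrt_neq0 alpha y : y != 0 -> csqrt alpha y != 0.
Proof. by move=> y0; rewrite csqrtE// cexp_neq0. Qed.

Lemma csqrtK alpha y : y != 0 -> csqrt alpha y * csqrt alpha y = y.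
Proof.
move=> y0; rewrite csqrtE// -cexpD -mulrDl.
have -> : 2^-1 + 2^-1 = 1 :> C by field.
by rewrite mul1r (clogP alpha y0).1.
Qed.

(** Halving [alpha] makes the two branches compatible: the logarithm of the
    square root is half the logarithm. *)
Lemma clog_csqrt alpha y : y != 0 ->
  clog (alpha / 2) (csqrt alpha y) = 2^-1 * clog alpha y.
Proof.
move=> y0; rewrite csqrtE//; apply: clog_unique.
have [_ /andP[h1 h2]] := clogP alpha y0.
have -> : complex.Im (2^-1 * clog alpha y : C) = complex.Im (clog alpha y) / 2.
  have -> : 2^-1 = (2^-1)%:C :> C by rewrite fmorphV rmorph_nat.
  by case: (clog _ _) => a b /=; rewrite mul0r addr0 mulrC.
by have := pi_gt0 R; move=> p0; apply/andP; split; lra.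
Qed.

Lemma cpow_csqrt alpha y z : y != 0 ->
  cpow (alpha / 2) (2 * csqrt alpha y / 2) z = cexp (z * (2^-1 * clog alpha y)).
Proof.
move=> y0; have -> : 2 * csqrt alpha y / 2 = csqrt alpha y by field.
by rewrite /cpow (negbTE (csqrt_neq0 alpha y0)) clog_csqrt.
Qed.

Lemma cexpMn z n : cexp (n%:R * z) = cexp z ^+ n.
Proof.
elim: n => [|n IH]; first by rewrite mul0r cexp0.
by rewrite -natr1 mulrDl mul1r cexpD IH exprSr.
Qed.

(** With all Gamma factors expressed through [1 / Gamma (1 + d)], the Bessel
    function of order [m - 1 + d] is a product of three factors that are
    differentiable in [d], also at the orders where a Gamma factor has a pole. *)
Lemma besselJ_order_diff : exists g : C, forall alpha y m, y != 0 ->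
  let l := 2^-1 * clog alpha y in let E := cexp ((m%:R - 1) * l) in
  besselJ (alpha / 2) (m%:R - 1) (2 * csqrt alpha y) = E * A m y /\
  cdiff (fun nu => besselJ (alpha / 2) nu (2 * csqrt alpha y)) (m%:R - 1)
    (E * ((g + l) * A m y + B m y)).
Proof.
have [G [g [r [/andP[r0 r1] G0 dG GE]]]] := recip_GammaE R.
exists g => alpha y m y0 l E.
pose F d := G d * cexp (l * d + (m%:R - 1) * l) * bessel_series (fun j => recip_gamma j d) m y.
have FE d : cabs d < Num.min r 2^-1 ->
    F d = besselJ (alpha / 2) (m%:R - 1 + d) (2 * csqrt alpha y).
  rewrite lt_min => /andP[dr d2].
  have h := bessel_has_sum m y (tame_recip_gamma (ltW d2)).
  rewrite /besselJ; symmetry; apply: has_sum_lim.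
  apply: has_sum_eq (has_sumZ (G d * cexp (l * d + (m%:R - 1) * l)) h) => k.
  have e1 : (Gamma (k%:R + 1 : C))^-1 = k`!%:R^-1.
    have := GE 0 k.+1; rewrite cabs0 add0r -natr1 G0 mul1r => -> //.
    by rewrite recip_gamma_at0.
  have e2 : (Gamma (m%:R - 1 + d + k%:R + 1))^-1 = G d * recip_gamma (k + m) d.
    by rewrite -GE//; congr (Gamma _)^-1; rewrite natrD; ring.
  rewrite invfM e1 e2 cpow_csqrt// -/l.
  have -> : (2 * k%:R + (m%:R - 1 + d)) * l =
      k%:R * clog alpha y + (l * d + (m%:R - 1) * l) by rewrite /l; field.
  rewrite [cexp (k%:R * _ + _)]cexpD cexpMn (clogP alpha y0).1 /bessel_coef; ring.
have dF : cdiff F 0 (E * ((g + l) * A m y + B m y)).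
  have d1 := cdiff_comp (cdiff_linear l ((m%:R - 1) * l) 0) (cdiff_cexp _).
  have := cdiffM (cdiffM dG d1) (bessel_series_cdiff_order m y).
  have -> : (fun j => recip_gamma j 0) = @rgamma0 R.
    by apply/funext => j; exact: recip_gamma_at0.
  rewrite G0 mulr0 add0r -/E.
  by set a := (X in cdiff _ _ X -> _); have -> : a = E * ((g + l) * A m y + B m y) by rewrite /a; ring.
have m0 : 0 < Num.min r 2^-1 by rewrite lt_min r0 invr_gt0 ltr0n.
split.
  have := FE 0; rewrite cabs0 addr0 => <- //.
  have e : (fun j => recip_gamma j 0) = @rgamma0 R.
    by apply/funext => j; exact: recip_gamma_at0.
  by rewrite /F G0 mulr0 add0r mul1r e.
rewrite -[m%:R - 1]addr0; apply/cdiff_shift.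
by apply: cdiff_near m0 _ dF => d dlt; rewrite add0r FE.
Qed.

Lemma cdiff_ccos z : cdiff (@ccos R) z (- csin z).
Proof.
have h1 := cdiff_comp (cdiff_linear 'i 0 z) (cdiff_cexp _).
have h2 := cdiff_comp (cdiff_linear (- 'i) 0 z) (cdiff_cexp _).
have := cdiffZ 2^-1 (cdiffD h1 h2); rewrite !addr0.
set a := (X in cdiff _ _ X -> _) => h.
have -> : - csin z = a.
  rewrite /a /csin mulNr.
  have i0 : 'i != 0 :> C by rewrite -sqrf_eq0 sqrCi oppr_eq0 oner_eq0.
  have -> : (cexp ('i * z) - cexp (- ('i * z))) / (2 * 'i) =
      - (2^-1 * ('i * (cexp ('i * z) - cexp (- ('i * z))))).
    have -> : (2 * 'i)^-1 = - 2^-1 * 'i :> C.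
      apply: (mulfI (x := 2 * 'i)); first by rewrite mulf_neq0// pnatr_eq0.
      rewrite mulfV ?mulf_neq0 ?pnatr_eq0//.
      have -> : 2 * 'i * (- 2^-1 * 'i) = - (2 / 2) * 'i ^+ 2 :> C by ring.
      by rewrite sqrCi mulfV ?pnatr_eq0// mulN1r opprK.
    ring.
  by ring.
by apply: cdiff_ext h => w; rewrite /ccos !addr0 mulNr mulrC.
Qed.

Lemma cdiff_csin z : cdiff (@csin R) z (ccos z).
Proof.
have i0 : 'i != 0 :> C by rewrite -sqrf_eq0 sqrCi oppr_eq0 oner_eq0.
have h1 := cdiff_comp (cdiff_linear 'i 0 z) (cdiff_cexp _).
have h2 := cdiff_comp (cdiff_linear (- 'i) 0 z) (cdiff_cexp _).
have := cdiffZ (2 * 'i)^-1 (cdiffB h1 h2); rewrite !addr0.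
set a := (X in cdiff _ _ X -> _) => h.
have -> : ccos z = a by rewrite /a /ccos mulNr; field.
by apply: cdiff_ext h => w; rewrite /csin !addr0 mulNr mulrC.
Qed.

Lemma ccos0 : ccos (0 : C) = 1.
Proof. by rewrite /ccos mulr0 oppr0 cexp0; field. Qed.

Lemma csin0 : csin (0 : C) = 0.
Proof. by rewrite /csin mulr0 oppr0 subrr mul0r. Qed.

Lemma cexp_ipi : cexp ('i * pi%:C : C) = -1.
Proof. by rewrite cexp_imag cospi sinpi; apply/eqP; rewrite eq_complex /= oppr0 !eqxx. Qed.

Lemma ccospi : ccos (pi%:C : C) = -1.
Proof. by rewrite /ccos cexpN cexp_ipi invrN1; field. Qed.

Lemma csinpi : csin (pi%:C : C) = 0.
Proof. by rewrite /csin cexpN cexp_ipi invrN1 subrr mul0r. Qed.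

Lemma piC_neq0 : pi%:C != 0 :> C.
Proof. by rewrite fmorph_eq0 gt_eqF// pi_gt0. Qed.

Lemma besselY_int alpha (n : int) z (l : C) :
  (fun mu => besselY_nonint alpha mu z) @ (n%:~R : C)^' --> l ->
  besselY alpha n%:~R z = l.
Proof.
move=> h; rewrite /besselY ifT; last by apply/asboolP; exists n.
by apply: cvg_lim h; exact: CC_hausdorff.
Qed.

(** At an integral order the numerator and the denominator defining [Y] both
    vanish, so the limit is the quotient of their derivatives in the order. For
    order [1] the function [J] is needed near [1] and near [-1]. *)
Lemma besselY01 : exists g : C, forall alpha y, y != 0 ->
  let l := g + 2^-1 * clog alpha y in let s := csqrt alpha y in
  besselY (alpha / 2) 0 (2 * s) = 2 / pi%:C * (l * A 1 y + B 1 y) /\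
  s * besselY (alpha / 2) 1 (2 * s) =
    (y * (l * A 2 y + B 2 y) - (l * A 0 y + B 0 y)) / pi%:C.
Proof.
have [g hg] := besselJ_order_diff; exists g => alpha y y0 l s.
have p0 := piC_neq0.
have dcos x : cdiff (fun mu : C => ccos (mu * pi%:C)) x (- csin (x * pi%:C) * pi%:C).
  have := cdiff_comp (cdiff_linear pi%:C 0 x) (cdiff_ccos _); rewrite addr0.
  rewrite [pi%:C * x]mulrC; apply: cdiff_ext => w; by rewrite addr0 mulrC.
have dsin x : cdiff (fun mu : C => csin (mu * pi%:C)) x (ccos (x * pi%:C) * pi%:C).
  have := cdiff_comp (cdiff_linear pi%:C 0 x) (cdiff_csin _); rewrite addr0.
  rewrite [pi%:C * x]mulrC; apply: cdiff_ext => w; by rewrite addr0 mulrC.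
pose J nu := besselJ (alpha / 2) nu (2 * s).
have dneg x b : cdiff J (- x) b -> cdiff (fun mu => J (- mu)) x (- b).
  have -> : - x = -1 * x + 0 by rewrite addr0 mulN1r.
  move=> h; have := cdiff_comp (cdiff_linear (-1) 0 x) h; rewrite mulrN1.
  by apply: cdiff_ext => w; rewrite addr0 mulN1r.
have [j0 d0] := hg alpha y 1%N y0; have [j1 d1] := hg alpha y 2%N y0.
have [jm dm] := hg alpha y 0%N y0.
rewrite -/s in j0 d0 j1 d1 jm dm.
pose f mu := J mu * ccos (mu * pi%:C) - J (- mu).
pose h (mu : C) := csin (mu * pi%:C).
split.
  have e0 : 1%:R - 1 = 0 :> C by rewrite subrr.
  rewrite e0 mul0r cexp0 !mul1r -/l in j0 d0.
  have df := cdiffB (cdiffM d0 (dcos 0)) (dneg 0 _ _); rewrite oppr0 in df.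
  have {}df := df _ d0; rewrite mul0r csin0 oppr0 mul0r mulr0 add0r ccos0 mul1r opprK in df.
  have dh := dsin 0; rewrite mul0r ccos0 mul1r in dh.
  have f0 : f 0 = 0 by rewrite /f mul0r ccos0 mulr1 oppr0 subrr.
  have h0 : h 0 = 0 by rewrite /h mul0r csin0.
  have lim := cdiff_quotient p0 f0 h0 df dh.
  rewrite (@besselY_int _ 0 _ _ lim).
  by move: (A 1 y) (B 1 y) (pi%:C : C) p0 => a b q q0; field.
have e2 : 2%:R - 1 = 1 :> C by ring.
have em : 0%:R - 1 = - 1 :> C by ring.
have yE : s * s = y := csqrtK alpha y0.
have s0 : s != 0 := csqrt_neq0 alpha y0.
have E1 : cexp ((2%:R - 1) * (2^-1 * clog alpha y)) = s by rewrite e2 mul1r /s csqrtE.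
have Em : cexp ((0%:R - 1) * (2^-1 * clog alpha y)) = s^-1.
  by rewrite em mulN1r cexpN /s csqrtE.
rewrite E1 e2 -/l in j1 d1; rewrite Em em -/l in jm dm.
have df := cdiffB (cdiffM d1 (dcos 1)) (dneg 1 _ dm).
rewrite mul1r csinpi oppr0 mul0r mulr0 add0r ccospi opprK in df.
have dh := dsin 1; rewrite mul1r ccospi mulN1r in dh.
have f1 : f 1 = 0.
  rewrite /f mul1r ccospi /J j1 jm bessel_A0E -yE; field; exact: s0.
have h1 : h 1 = 0 by rewrite /h mul1r csinpi.
have np0 : - pi%:C != 0 :> C by rewrite oppr_eq0.
have lim := cdiff_quotient np0 f1 h1 df dh.
rewrite (@besselY_int _ 1 _ _ lim) -yE.
move: (A 2 _) (B 2 _) (A 0 _) (B 0 _) (pi%:C : C) p0 => a b a' b' q q0.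
by field; rewrite q0 s0.
Qed.

End BesselFunctions.

(** * The first integral of the Hill form *)

Section HillForm.
Variable R : realType.
Local Notation C := (CC R).
Local Notation C2 := (CC R * CC R)%type.
Local Notation A := (bessel_series (@rgamma0 R)).
Local Notation B := (bessel_series (@rgamma1 R)).
Implicit Types (x y : C) (p q : C2) (alpha : R).

(** The left-hand side is entire and its derivative vanishes identically, so it
    keeps its value at the origin. *)
Lemma bessel_wronskian y : A 1 y * B 0 y - 2^-1 * (A 1 y * A 1 y) - B 1 y * A 0 y = 2^-1.
Proof.
pose q z := A 1 z * B 0 z - 2^-1 * (A 1 z * A 1 z) - B 1 z * A 0 z.
have dA m z : cdiff (A m) z (- A m.+1 z).
  exact: analytic1_cdiff (bessel_analytic1 m z (@tame_rgamma0 R)).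
have dB m z : cdiff (B m) z (- B m.+1 z).
  exact: analytic1_cdiff (bessel_analytic1 m z (@tame_rgamma1 R)).
have dq z : cdiff q z 0.
  have := cdiffB (cdiffB (cdiffM (dA 1%N z) (dB 0%N z))
    (cdiffZ 2^-1 (cdiffM (dA 1%N z) (dA 1%N z)))) (cdiffM (dB 1%N z) (dA 0%N z)).
  set a := (X in cdiff _ _ X -> _); suff -> : a = 0 by [].
  by rewrite /a bessel_A0E bessel_B0E; field.
have := @cdiff0_cst _ q 0 y (fun t _ => dq _); rewrite add0r /q => ->.
rewrite !(bessel_series_at0 _ (@tame_rgamma0 R)) !(bessel_series_at0 _ (@tame_rgamma1 R)).
by rewrite [rgamma0 _ 0]/= mulr0 subr0 /= invr1 !mulr1; field.
Qed.

Definition half_log alpha (g : C) y : C := g + 2^-1 * clog alpha y.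

(** [hill_u] and [hill_v] are [J_0 (2 sqrt y)] and, when [g] is the Euler constant,
    [Y_0 (2 sqrt y)]: two solutions of [y u'' + u' + u = 0].  The functions [hill_U]
    and [hill_V] are [y] times their derivatives, that is
    [- sqrt y * J_1 (2 sqrt y)] and [- sqrt y * Y_1 (2 sqrt y)]. *)
Definition hill_u : C -> C := A 1.
Definition hill_U : C -> C := A 0.
Definition hill_v alpha g y : C :=
  2 / pi%:C * (half_log alpha g y * A 1 y + B 1 y).
Definition hill_V alpha g y : C :=
  2 / pi%:C * (half_log alpha g y * A 0 y + (B 0 y - 2^-1 * A 1 y)).

Lemma hill_formula : exists g : C, forall alpha p, p.2 != 0 ->
  hill_den alpha p = p.1 * hill_u p.2 + hill_U p.2 /\
  hill_num alpha p = 2 * (p.1 * hill_v alpha g p.2 + hill_V alpha g p.2).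
Proof.
have [g1 hJ] := besselJ_order_diff R.
have [g hY] := besselY01 R; exists g => alpha [x y] /= y0.
have [j0 _] := hJ alpha y 1%N y0; have [j1 _] := hJ alpha y 2%N y0.
have [Y0 Y1] := hY alpha y y0.
have e0 : 1%:R - 1 = 0 :> C by rewrite subrr.
have e2 : 2%:R - 1 = 1 :> C by ring.
rewrite e0 mul0r cexp0 mul1r in j0; rewrite e2 mul1r -csqrtE// in j1.
have yE := csqrtK alpha y0.
rewrite /hill_den /hill_num /= j0 j1 Y0; split.
  by rewrite mulrA yE /hill_u /hill_U bessel_A0E mulNr.
rewrite -[2 * csqrt _ _ * _]mulrA Y1 /hill_v /hill_V /half_log bessel_B0E bessel_A0E.
move: (A 1 y) (A 2 y) (B 1 y) (B 2 y) (clog alpha y) (pi%:C : C) (@piC_neq0 R).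
by move=> a1 a2 b1 b2 l w w0; field.
Qed.

(** The logarithmic terms cancel. *)
Lemma hill_wronskian alpha g y :
  hill_u y * hill_V alpha g y - hill_v alpha g y * hill_U y = (pi%:C)^-1.
Proof.
rewrite /hill_u /hill_V /hill_v /hill_U.
have := bessel_wronskian y.
move: (A 1 y) (A 0 y) (B 1 y) (B 0 y) (half_log _ _ _) ((pi%:C)^-1 : C).
move=> a1 a0 b1 b0 l w h.
have -> : a1 * (2 * w * (l * a0 + (b0 - 2^-1 * a1))) - 2 * w * (l * a1 + b1) * a0
  = 2 * w * (a1 * b0 - 2^-1 * (a1 * a1) - b1 * a0) by ring.
by rewrite h; field.
Qed.

Lemma analytic2_jet (f : C2 -> C) p (dx dy dx' dy' : C) : dx = dx' -> dy = dy' ->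
  analytic2 f p dx dy -> analytic2 f p dx' dy'.
Proof. by move=> -> ->. Qed.

Section Jets.
Variables (alpha : R) (g : C) (p : C2).
Hypothesis np : slit_domain alpha p.
Let y := p.2.

Let y0 : y != 0. Proof. by have [] := clog_off_slit np. Qed.

Let jA m : analytic2 (fun q => A m q.2) p 0 (- A m.+1 y).
Proof. exact: analytic2_snd (bessel_analytic1 m y (@tame_rgamma0 R)). Qed.

Let jB m : analytic2 (fun q => B m q.2) p 0 (- B m.+1 y).
Proof. exact: analytic2_snd (bessel_analytic1 m y (@tame_rgamma1 R)). Qed.

Let jl : analytic2 (fun q => half_log alpha g q.2) p 0 (2^-1 * y^-1).
Proof.
have := analytic2D (analytic2_cst g p) (analytic2Z 2^-1 (analytic2_snd (clog_analytic1 np))).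
by apply: analytic2_jet; rewrite ?mulr0 add0r.
Qed.

Lemma analytic2_hill_u : analytic2 (fun q => hill_u q.2) p 0 (hill_U y / y).
Proof.
apply: analytic2_jet (jA 1%N) => //; rewrite /hill_U bessel_A0E; field; exact: y0.
Qed.

Lemma analytic2_hill_U : analytic2 (fun q => hill_U q.2) p 0 (- hill_u y).
Proof. exact: jA 0%N. Qed.

Lemma analytic2_hill_v :
  analytic2 (fun q => hill_v alpha g q.2) p 0 (hill_V alpha g y / y).
Proof.
have := analytic2Z (2 / pi%:C) (analytic2D (analytic2M jl (jA 1%N)) (jB 1%N)).
apply: analytic2_jet; first by ring.
rewrite /hill_V -/y bessel_B0E bessel_A0E; move: (2 / pi%:C : C) => w.
by field; exact: y0.
Qed.

Lemma analytic2_hill_V :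
  analytic2 (fun q => hill_V alpha g q.2) p 0 (- hill_v alpha g y).
Proof.
have := analytic2Z (2 / pi%:C) (analytic2D (analytic2M jl (jA 0%N))
  (analytic2D (jB 0%N) (analytic2Z (- 2^-1) (jA 1%N)))).
move=> h; apply: analytic2_jet (analytic2_ext _ h).
- by ring.
- rewrite /hill_v -/y bessel_A0E; move: (2 / pi%:C : C) => w.
  by field; exact: y0.
- by move=> q; rewrite /hill_V mulNr.
Qed.

End Jets.


Lemma hill_near (f h : C2 -> C) p dx dy : p.2 != 0 ->
  (forall q, q.2 != 0 -> f q = h q) -> analytic2 f p dx dy -> analytic2 h p dx dy.
Proof.
move=> y0 fh; apply: (@analytic2_near _ _ _ _ _ _ (cabs p.2)); first by rewrite cabs_gt0.
move=> a k _ ky; apply: fh => /=; rewrite addr_eq0.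
by apply: contraTneq ky => ->; rewrite cabsN ltxx.
Qed.

(** With [u' = U / y], [U' = - u] and likewise for [v] and [V], the numerator of the
    differential of the quotient is the Wronskian times the Hill form, up to the
    factor [2 / y].  The Wronskian also excludes a common zero of the two linear
    forms in [x]. *)
Lemma hill_jets alpha p : slit_domain alpha p ->
  exists dnx dny ddx ddy : C,
  [/\ analytic2 (hill_num alpha) p dnx dny, analytic2 (hill_den alpha) p ddx ddy,
    dnx * hill_den alpha p - hill_num alpha p * ddx = - (2 / pi%:C),
    dny * hill_den alpha p - hill_num alpha p * ddy =
      2 / pi%:C * (p.1 ^+ 2 + p.2) / p.2 &
    hill_den alpha p = 0 -> hill_num alpha p != 0].
Proof.
move=> np; have [g hg] := hill_formula; have [y0 _ _] := clog_off_slit np.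
have ju := analytic2_hill_u np; have jU := analytic2_hill_U p.
have jv := analytic2_hill_v g np; have jV := analytic2_hill_V g np.
have W := hill_wronskian alpha g p.2.
have jn := analytic2Z 2 (analytic2D (analytic2M (analytic2_fst p) jv) jV).
have jd := analytic2D (analytic2M (analytic2_fst p) ju) jU.
have nE q : q.2 != 0 -> hill_num alpha q = 2 * (q.1 * hill_v alpha g q.2 + hill_V alpha g q.2).
  by move=> /(hg alpha)[].
have dE q : q.2 != 0 -> hill_den alpha q = q.1 * hill_u q.2 + hill_U q.2.
  by move=> /(hg alpha)[].
eexists _, _, _, _; split.
- by apply: hill_near jn => // q q0; rewrite nE.
- by apply: hill_near jd => // q q0; rewrite dE.
- rewrite nE// dE// -W.
  by move: (hill_u _) (hill_U _) (hill_v _ _ _) (hill_V _ _ _) => a b c d; ring.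
- rewrite nE// dE// -W.
  move: (hill_u _) (hill_U _) (hill_v _ _ _) (hill_V _ _ _) => a b c d.
  by field.
- rewrite nE// dE// => /eqP; rewrite addrC addr_eq0 => /eqP e.
  rewrite mulf_neq0 ?pnatr_eq0//; apply: contraNneq (_ : (pi%:C)^-1 != 0 :> C).
    move=> /eqP; rewrite addrC addr_eq0 => /eqP e'; rewrite -W e e'.
    by apply/eqP; ring.
  by rewrite invr_eq0 piC_neq0.
Qed.

Lemma hill_F_jet alpha p : slit_domain alpha p -> hill_den alpha p != 0 ->
  let k := 2 / pi%:C / (p.2 * hill_den alpha p ^+ 2) in
  analytic2 (hill_F alpha) p (k * - p.2) (k * (p.1 ^+ 2 + p.2)).
Proof.
move=> np d0 k.
have [y0 _ _] := clog_off_slit np.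
have [nx [ny [dx [dy [jn jd ex ey _]]]]] := hill_jets np.
have e a b : hill_num alpha p * (- b / hill_den alpha p ^+ 2) + a / hill_den alpha p =
    (a * hill_den alpha p - hill_num alpha p * b) / hill_den alpha p ^+ 2.
  by field.
apply: analytic2_jet (analytic2M jn (analytic2V jd d0)).
- by rewrite e ex /k; move: (2 / _) => c; field; rewrite y0 d0.
- by rewrite e ey /k; move: (2 / _) => c; field; rewrite y0 d0.
Qed.

(** For a fixed [y] the quotient is a homography in [x] whose determinant is the
    Wronskian, so it is injective. *)
Lemma hill_F_nonconstant alpha : exists p q : C2,
  [/\ slit_domain alpha p /\ hill_den alpha p != 0,
      slit_domain alpha q /\ hill_den alpha q != 0 & hill_F alpha p != hill_F alpha q].
Proof.
have [g hg] := hill_formula.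
pose w : C := 'i * alpha%:C; pose y := cexp w.
have wE : complex.Im w = alpha by rewrite /w /= !mul0r mul1r add0r.
have ns : ~ slit_ray alpha y.
  have := pi_gt0 R => p0; move/slit_rayP; rewrite wE.
  by move=> /(_ _)h; have := h; rewrite (_ : _ && _ = true); [move=> /(_ isT)|]; lra.
have y0 : y != 0 := cexp_neq0 w.
have W := hill_wronskian alpha g y.
have W0 : (pi%:C)^-1 != 0 :> C by rewrite invr_eq0 piC_neq0.
have F x1 x2 (d1 d2 : C) : x1 * hill_u y + hill_U y = d1 -> x2 * hill_u y + hill_U y = d2 ->
    d1 != 0 -> d2 != 0 -> x1 != x2 -> exists p q : C2,
    [/\ slit_domain alpha p /\ hill_den alpha p != 0,
    slit_domain alpha q /\ hill_den alpha q != 0 & hill_F alpha p != hill_F alpha q].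
  move=> e1 e2 n1 n2 x12; exists (x1, y), (x2, y).
  have [D1 N1] := hg alpha (x1, y) y0; have [D2 N2] := hg alpha (x2, y) y0.
  rewrite /hill_F D1 D2 N1 N2 /= e1 e2; split=> //.
  rewrite -subr_eq0 -mulNr addf_div//; apply: mulf_neq0; last by rewrite invr_eq0 mulf_neq0.
  rewrite -e1 -e2.
  set t := (X in X != 0).
  have -> : t = 2 * (x2 - x1) * (hill_u y * hill_V alpha g y - hill_v alpha g y * hill_U y).
    by rewrite /t; ring.
  by rewrite W !mulf_neq0 ?pnatr_eq0// subr_eq0 eq_sym.
have [u0|u0] := eqVneq (hill_u y) 0.
  have U0 : hill_U y != 0.
    by apply: contraNneq W0 => U0; rewrite -W u0 U0 mul0r mulr0 subrr.
  apply: (F 0 1 (hill_U y) (hill_U y)) => //; rewrite ?u0 ?mulr0 ?add0r//.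
  by rewrite eq_sym oner_eq0.
(* These abscissas give the denominator the values [1] and [2]. *)
apply: (F ((1 - hill_U y) / hill_u y) ((2 - hill_U y) / hill_u y) 1 2).
- by rewrite divfK// subrK.
- by rewrite divfK// subrK.
- exact: oner_neq0.
- by rewrite pnatr_eq0.
apply/eqP => /(mulIf _) h; have := h (invr_neq0 u0) => /addIr /eqP.
by rewrite -subr_eq0 (_ : 1 - 2 = - 1); [rewrite oppr_eq0 oner_eq0|ring].
Qed.

End HillForm.

Theorem theorem2 (R : realType) (alpha : R) :
  [/\ open (slit_domain alpha),
      first_integral (@Omega2 R)
        (slit_domain alpha `&` [set p | hill_den alpha p != 0])
        (hill_F alpha),
      forall p : CC R * CC R, slit_domain alpha p -> hill_den alpha p != 0 ->
        analytic_at (hill_F alpha) p &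
      forall p : CC R * CC R, slit_domain alpha p -> hill_den alpha p = 0 ->
        hill_num alpha p != 0 /\
        analytic_at (fun q => (hill_F alpha q)^-1) p].
Proof.
split.
- exact: open_slit_domain.
- split.
  + by move=> p [np d0]; have [] := analytic2_diff (hill_F_jet np d0).
  + have [p [q [[np dp] [nq dq] pq]]] := hill_F_nonconstant alpha.
    by exists p, q.
  + move=> p [np d0] u v; have [_ dE] := analytic2_diff (hill_F_jet np d0).
    by rewrite /wedge /exterior_d /Omega2 /form1 !dE; ring.
- by move=> p np d0; exact: analytic2_at (hill_F_jet np d0).
- move=> p np d0; have [nx [ny [dx [dy [jn jd _ _ n0]]]]] := hill_jets np.
  split; first exact: n0.
  have h := analytic2M jd (analytic2V jn (n0 d0)).
  have := analytic2_at h; congr (analytic_at _ p).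
  by apply/funext => q; rewrite /hill_F invf_div.
Qed.
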